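(* Let $d\ge 1$, let $p_1,\dots,p_d\ge 2$ be integers, and let $\mathcal{T}(x)$ be the Terwilliger algebra of the wreath product of cyclic schemes $C_{p_1}\wr C_{p_2}\wr\cdots\wr C_{p_d}$ with respect to a vertex $x$. Let $\mathcal{U}\subseteq\mathcal{T}(x)$ be the $\mathbb{C}$-subspace spanned by the matrices $G_{(i,\alpha)(j,\beta)}$, and let $F_{(i,\alpha)(h,\xi)}$ be the matrices, both defined in the context. (1) $\mathcal{U}$ is a $\mathbb{C}$-algebra isomorphic to $M_{1+\sum_{i=1}^d(p_i-1)}(\mathbb{C})$. (2) $\mathcal{U}$ is an ideal of $\mathcal{T}(x)$ and $\mathcal{T}(x)/\mathcal{U}$ is commutative. (3) The set $\{F_{(i,\alpha)(h,\xi)}\mid 2\le i\le d,\ 1\le\alpha\le p_i-1,\ 1\le h\le i-1,\ 1\le\xi\le p_h-1\}$ has $\sum_{1\le h<i\le d}(p_h-1)(p_i-1)$ nonzero elements, and each nonzero element is a central idempotent that spans a $1$-dimensional non-primary ideal of $\mathcal{T}(x)$. (4) $\mathcal{T}(x)\simeq M_{1+\sum_{i=1}^d(p_i-1)}(\mathbb{C})\oplus M_1(\mathbb{C})^{\oplus\sum_{1\le h<i\le d}(p_h-1)(p_i-1)}$.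
   Context: The cyclic scheme $C_n$ of order $n$ is the association scheme on $\{x_0,\dots,x_{n-1}\}$ with relations $R_j=\{(x_a,x_{a+j})\}$, $0\le j\le n-1$, subscripts modulo $n$. The wreath product $\chi\wr\psi$ of association schemes $\chi=(X,\{R_k\}_{0\le k\le d})$ and $\psi=(Y,\{S_k\}_{0\le k\le e})$ is the scheme on $X\times Y$ with relations $W_0$ the diagonal, $W_k=\{((x_1,y),(x_2,y))\mid (x_1,x_2)\in R_k,\ y\in Y\}$ for $1\le k\le d$, and $W_k=\{((x_1,y_1),(x_2,y_2))\mid x_1,x_2\in X,\ (y_1,y_2)\in S_{k-d}\}$ for $d+1\le k\le d+e$. Accordingly $C_{p_1}\wr\cdots\wr C_{p_d}$ has vertex set $X=X_1\times\cdots\times X_d$ with $X_i=\{x_{i,0},\dots,x_{i,p_i-1}\}$, and its relations are the diagonal $R_0$ and, for $1\le i\le d$ and $1\le\alpha\le p_i-1$, the relation $R_{(i,\alpha)}$ consisting of all pairs $(x,y)$ such that $x$ and $y$ have the same $j$-th coordinate for every $j>i$, and the $i$-th coordinates are $x_{i,a}$ and $x_{i,a+\alpha}$ (second subscript modulo $p_i$) for some $a$; there is no condition on coordinates $j<i$. The index pair $(i,\alpha)$, $1\le i\le d$, $1\le\alpha\le p_i-1$, is identified with the integer $\sum_{j=1}^{i-1}(p_j-1)+\alpha$, and $(0,\alpha)$ is identified with $0$ whatever $\alpha$ is; so the relations are indexed by $[\sum_{i=1}^d(p_i-1)]=\{0,1,\dots,\sum_{i=1}^d(p_i-1)\}$.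 $A_{(i,\alpha)}\in Mat_{|X|}(\mathbb{C})$ is the adjacency matrix of $R_{(i,\alpha)}$ (entry $1$ at $yz$ if $(y,z)\in R_{(i,\alpha)}$, else $0$); $n_{(i,\alpha)}$ is the valency, i.e. the number of $y$ with $(x,y)\in R_{(i,\alpha)}$; $J$ is the all-ones matrix. Fix $x\in X$. $E^*_{(i,\alpha)}=E^*_{(i,\alpha)}(x)$ is the diagonal matrix with $yy$ entry $1$ if $(x,y)\in R_{(i,\alpha)}$ and $0$ otherwise. The Terwilliger algebra $\mathcal{T}(x)$ is the subalgebra of $Mat_{|X|}(\mathbb{C})$ generated by all $A_{(i,\alpha)}$ and all $E^*_{(i,\alpha)}$. For $(i,\alpha),(j,\beta)\in[\sum_{i=1}^d(p_i-1)]$ put $G_{(i,\alpha)(j,\beta)}=\frac{1}{n_{(j,\beta)}}E^*_{(i,\alpha)}A_{(j,\beta)}E^*_{(j,\beta)}$ if $i<j$; $G_{(i,\alpha)(j,\beta)}=\frac{1}{n_{(j,\beta)}}E^*_{(i,\alpha)}A_{(i,\alpha)}^tE^*_{(j,\beta)}$ if $i>j$; $G_{(i,\alpha)(j,\beta)}=\frac{1}{n_{(i,\alpha)}}E^*_{(i,\alpha)}JE^*_{(i,\beta)}$ if $i=j$. For $2\le i\le d$, $1\le\alpha\le p_i-1$, $1\le h\le i-1$, $1\le\xi\le p_h-1$ put $$F_{(i,\alpha)(h,\xi)}=\frac{1}{p_hn_{(h,\xi)}}E^*_{(i,\alpha)}\Big(\sum_{r=0}^{(h-1,\,p_{h-1}-1)}A_r+\varepsilon^{\xi}A_{(h,1)}+\varepsilon^{2\xi}A_{(h,2)}+\cdots+\varepsilon^{(p_h-1)\xi}A_{(h,p_h-1)}\Big)E^*_{(i,\alpha)},$$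 where $\varepsilon=e^{2\pi\sqrt{-1}/p_h}$ and the sum over $r$ runs over all indices $r$ that are $0$ or of the form $(g,\gamma)$ with $1\le g\le h-1$. The primary module is the irreducible $\mathcal{T}(x)$-module $\mathrm{Span}\{E_r^*\mathbf{1}\mid r\in[\sum_{i=1}^d(p_i-1)]\}\subseteq\mathbb{C}X$, where $\mathbf{1}$ is the all-ones vector; an ideal of $\mathcal{T}(x)$ is called non-primary if it acts as zero on the primary module. *)

(* Defs.v *)
From HB Require Import structures.
From mathcomp Require Import all_boot all_order all_algebra all_field.
From mathcomp Require Import complex.
From mathcomp Require Import reals trigo.

Set Implicit Arguments.
Unset Strict Implicit.
Unset Printing Implicit Defensive.

Import GRing.Theory.
Local Open Scope ring_scope.

(* A notation, because the zero algebra has no lalgType structure and yet may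
   occur as a factor of B. *)
Notation alg_isom A B := (exists f : {lrmorphism A -> B}, bijective f).

Definition is_ideal (K : fieldType) (aT : falgType K) (T I : {vspace aT}) :=
  [&& (I <= T)%VS, (T * I <= I)%VS & (I * T <= I)%VS].

(* The quotient rings of ring_quotient are restricted to proper ideals of
   commutative rings, so only the additive quotient is taken from there; the
   product of classes is well defined by pi_alg_quot_mul. *)
Section AlgebraQuotient.
Variables (K : fieldType) (aT : falgType K) (T : {aspace aT}).
Variable U : {vspace aT}.

Definition vs_ideal : {pred subvs_of T} := fun a => vsval a \in U.

Fact vs_ideal_zmod_closed : zmod_closed vs_ideal.
Proof.
split=> [|a b]; rewrite /vs_ideal !unfold_in ?linear0 ?linearB; first exact: mem0v.
exact: memvB.
Qed.

HB.instance Definition _ :=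
  GRing.isZmodClosed.Build (subvs_of T) vs_ideal vs_ideal_zmod_closed.

Local Open Scope quotient_scope.

Definition alg_quot := Quotient.quot (vs_ideal : zmodClosed (subvs_of T)).

Definition alg_quot_mul (a b : alg_quot) : alg_quot :=
  \pi_alg_quot (repr a * repr b).

Lemma pi_alg_quot_mul : is_ideal T U ->
  {morph \pi_alg_quot : a b / a * b >-> alg_quot_mul a b}.
Proof.
case/and3P=> _ TU UT a b; rewrite /alg_quot_mul.
have piE c d : (\pi_alg_quot c = \pi_alg_quot d) <-> (vsval (c - d) \in U).
  have E : (vsval (c - d) \in U) = (c == d %[mod alg_quot]).
    exact: (Quotient.idealrBE (vs_ideal : zmodClosed (subvs_of T)) c d).
  by rewrite E; split=> /eqP.
apply/piE.
set a' := repr _; set b' := repr _.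
have aU : vsval (a - a') \in U by apply/piE; rewrite reprK.
have bU : vsval (b - b') \in U by apply/piE; rewrite reprK.
have -> : a * b - a' * b' = (a - a') * b + a' * (b - b').
  by rewrite mulrBl mulrBr addrA subrK.
rewrite linearD rpredD //=.
  by apply: (subvP UT); rewrite memv_mul // subvsP.
by apply: (subvP TU); rewrite memv_mul // subvsP.
Qed.

End AlgebraQuotient.

Section Terwilliger.
Variables (K : fieldType) (X I : finType) (R : I -> rel X) (x : X).

(* Matrices indexed by X are indexed through enum_val; the dimension is
   written as a successor so that they form a (nonzero) unital algebra. *)
Fact card_pred_vertex : #|X|.-1.+1 = #|X|.
Proof. by apply/prednK/card_gt0P; exists x. Qed.

Definition nth_vertex (a : 'I_#|X|.-1.+1) : X :=
  enum_val (cast_ord card_pred_vertex a).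

Definition vmatrix := 'M[K]_#|X|.-1.+1.

Definition valency (r : I) : nat := #|[set y | R r x y]|.

Definition adjacency (r : I) : vmatrix :=
  \matrix_(a, b) (R r (nth_vertex a) (nth_vertex b))%:R.

Definition dual_idempotent (r : I) : vmatrix :=
  diag_mx (\row_a (R r x (nth_vertex a))%:R).

Definition all_ones : vmatrix := const_mx 1.

Definition terwilliger : {aspace vmatrix} :=
  << <<[seq adjacency r | r : I] ++ [seq dual_idempotent r | r : I]>> >>%AS.

Definition ones_vector : 'cV[K]_#|X|.-1.+1 := const_mx 1.

Definition primary_module : {vspace 'cV[K]_#|X|.-1.+1} :=
  <<[seq dual_idempotent r *m ones_vector | r : I]>>%VS.

Definition nonprimary (V : {vspace vmatrix}) : Prop :=
  forall M v, M \in V -> v \in primary_module -> M *m v = 0.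

End Terwilliger.

Definition cyclic_rel (n k : nat) : rel 'I_n :=
  fun a b => b == ((a + k) %% n)%N :> nat.

Definition wreath_rel (X Y : finType) (I J : Type)
    (R : option I -> rel X) (S : option J -> rel Y)
    (k : option (I + J)) : rel (X * Y) := fun u v =>
  match k with
  | None => u == v
  | Some (inl k) => R (Some k) u.1 v.1 && (u.2 == v.2)
  | Some (inr k) => S (Some k) u.2 v.2
  end.

(* Coordinates are indexed by 'I_d, i.e. from 0 to d-1.  The pair (i, alpha)
   is the label Some (Tagged _ a) with a = alpha - 1 : 'I_(p i).-1, and None
   is the index 0 of the diagonal. *)
Section CyclicWreath.
Variables (d : nat) (p : 'I_d -> nat).

Definition vertex := {dffun forall i : 'I_d, 'I_(p i)}.

Definition label := {i : 'I_d & 'I_(p i).-1}.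

Definition cyclic_wreath (r : option label) : rel vertex := fun y z =>
  match r with
  | None => y == z
  | Some u => [forall j : 'I_d, (tag u < j)%N ==> (y j == z j)]
              && cyclic_rel (tagged u).+1 (y (tag u)) (z (tag u))
  end.

(* The first component of an index, counted from 1 as (0, alpha) is None. *)
Definition level (r : option label) : nat :=
  if r is Some u then (tag u).+1 else 0%N.

Definition primary_dim : nat := (\sum_i (p i).-1)%N.+1.

Definition nonprimary_count : nat :=
  (\sum_(i < d) \sum_(h < d | h < i) (p h).-1 * (p i).-1)%N.

End CyclicWreath.

(* C_(p_1) wr ... wr C_(p_(d+1)) is the binary wreath product of
   C_(p_1) wr ... wr C_(p_d) by C_(p_(d+1)). *)
Section CyclicWreathRec.
Variables (d : nat) (p : 'I_d.+1 -> nat).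

Let w (j : 'I_d) : 'I_d.+1 := widen_ord (leqnSn d) j.
Let q (j : 'I_d) := p (w j).

Definition split_vertex (y : vertex p) : vertex q * 'I_(p ord_max) :=
  ([ffun j => y (w j)], y ord_max).

Definition cyclic_scheme n (k : option 'I_n.-1) : rel 'I_n :=
  cyclic_rel (if k is Some a then a.+1 else 0%N).

Definition join_label (k : option (label q + 'I_(p ord_max).-1)) :
    option (label p) :=
  match k with
  | None => None
  | Some (inl u) => Some (Tagged (fun i => 'I_(p i).-1)
                            (tagged u : 'I_(p (w (tag u))).-1))
  | Some (inr a) => Some (Tagged (fun i => 'I_(p i).-1) a)
  end.

Lemma ord_widen_or_max (i : 'I_d.+1) : i = ord_max \/ exists j, i = w j.
Proof.
have [lt_id|] := ltnP i d; last first.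
  by move=> le_di; left; apply/val_inj/eqP; rewrite eqn_leq le_di -ltnS ltn_ord.
by right; exists (Ordinal lt_id); apply: val_inj.
Qed.

Lemma split_vertex_inj : injective split_vertex.
Proof.
move=> y z [] /ffunP eq_w eq_max; apply/ffunP=> i.
by case: (ord_widen_or_max i) => [|[j]] -> //; have := eq_w j; rewrite !ffunE.
Qed.

Lemma cyclic_wreath_recr k (y z : vertex p) :
  cyclic_wreath (join_label k) y z =
  wreath_rel (@cyclic_wreath d q) (@cyclic_scheme (p ord_max)) k
    (split_vertex y) (split_vertex z).
Proof.
case: k => [[u|a]|] /=; last by rewrite (inj_eq split_vertex_inj).
  rewrite !ffunE andbAC; congr (_ && _); apply/forallP/andP.
    move=> eq_yz; split; last by have := eq_yz ord_max; rewrite /= ltn_ord.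
    by apply/forallP=> j; have := eq_yz (w j); rewrite !ffunE.
  case=> /forallP eq_yz eq_max i.
  case: (ord_widen_or_max i) => [|[j]] ->; first by rewrite eq_max implybT.
  by have := eq_yz j; rewrite !ffunE.
rewrite (_ : [forall j, _]) //; apply/forallP=> j.
by rewrite ltnNge -ltnS ltn_ord.
Qed.

End CyclicWreathRec.

Section Matrices.
Variables (R : realType) (d : nat) (p : 'I_d -> nat) (x : vertex p).

Local Notation C := R[i].
Local Notation n_ := (valency (@cyclic_wreath d p) x).
Local Notation A_ := (adjacency C (@cyclic_wreath d p) x).
Local Notation E_ := (dual_idempotent C (@cyclic_wreath d p) x).
Local Notation J := (all_ones C (vertex p)).

Definition root_of_unity (n : nat) : C :=
  (cos (2 * pi / n%:R) +i* sin (2 * pi / n%:R))%C.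

Definition cw_terwilliger := terwilliger C (@cyclic_wreath d p) x.

Definition Gmx (r s : option (label p)) : vmatrix C (vertex p) :=
  if (level r < level s)%N then (n_ s)%:R^-1 *: (E_ r * A_ s * E_ s)
  else if (level s < level r)%N then (n_ s)%:R^-1 *: (E_ r * (A_ r)^T * E_ s)
  else (n_ r)%:R^-1 *: (E_ r * J * E_ s).

Definition Uspace : {vspace vmatrix C (vertex p)} :=
  <<[seq Gmx w.1 w.2 | w : option (label p) * option (label p)]>>%VS.

Definition Fmx (u v : label p) : vmatrix C (vertex p) :=
  let h := tag v in let xi := (tagged v).+1 in
  ((p h)%:R * (n_ (Some v))%:R)^-1 *:
    (E_ (Some u)
     * (\sum_(r | (level r < level (Some v))%N) A_ r
        + \sum_(k < (p h).-1) root_of_unity (p h) ^+ (k.+1 * xi) *: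
            A_ (Some (Tagged (fun i => 'I_(p i).-1) k)))
     * E_ (Some u)).

Definition Fmxs : seq (vmatrix C (vertex p)) :=
  [seq Fmx w.1 w.2 | w : label p * label p <- enum {: label p * label p}
                   & (tag w.2 < tag w.1)%N].

End Matrices.

(* Main.v *)
From HB Require Import structures.
Require Import Defs.
From mathcomp Require Import all_boot all_order all_algebra all_field.
From mathcomp Require Import complex.
From mathcomp Require Import reals trigo.
From mathcomp Require Import ring lra.

Set Implicit Arguments.
Unset Strict Implicit.
Unset Printing Implicit Defensive.

Import Order.TTheory GRing.Theory Num.Theory.
Local Open Scope ring_scope.

(** Write E_r for the dual idempotents, J for the all-ones matrix and call
    block r the set of vertices in relation r with the base vertex x.  Two
    facts about the scheme drive the proof.

    Between two distinct blocks r and s a relation is all or nothing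
    (rel_between_blocks): E_r A_k E_s is either 0 or E_r J E_s.  Hence every
    G_rs equals (1 / n_s) E_r J E_s (Gmx_kernel), and the G_rs satisfy the
    rules of matrix units, because n_s is the size of the block s (Gmx_mul).

    Inside a block u of tag i all vertices agree at the coordinates >= i, and
    the matrices E_u A_k E_u form the adjacency algebra of the wreath product
    of the first i cyclic schemes.  The nontrivial characters of the cyclic
    group of order p_h, lifted to the coordinate h and averaged over the
    coordinates below h, are the primitive idempotents of that algebra other
    than G_uu, and these are the matrices F (Fmx_kernel).  A nontrivial
    character sums to 0 over the group, so the matrices F are orthogonal
    idempotents that annihilate the G_rs on both sides (Fkernel_mul,
    Fkernel_row_sum, Fkernel_col_sum).  Fourier inversion on the coordinate h expresses
    E_u A_(h,c) E_u through the F with that h and the average over the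
    coordinates <= h; since the averages telescope as h decreases
    (shift_kernel_fourier, agree_kernel_span), every E_r A_k E_s is a
    combination of the G and the F.

    Therefore T(x) is exactly the span of the G and the F (terwilliger_span).
    The structure constants of an algebra spanned by matrix units and by nonzero
    orthogonal idempotents that annihilate them show that it is the direct sum
    of a matrix algebra and of lines, one for each idempotent
    (comb_span_isom). *)

(** * Algebras spanned by matrix units and orthogonal idempotents *)

Lemma mem_span_image (K : fieldType) (V : vectType K) (I : finType)
    (f : I -> V) (v : V) :
  v \in <<[seq f i | i : I]>>%VS <-> exists c : I -> K, v = \sum_i c i *: f i.
Proof.
split=> [|[c ->]]; last first.
  by apply: memv_suml => i _; apply/memvZ/memv_span/image_f.
rewrite span_def big_image => /memv_sumP[w w_line ->].
exists (fun i => sval (sig_eqW (vlineP _ _ (w_line i isT)))).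
by apply: eq_bigr => i _; case: (sig_eqW _).
Qed.

(** The target B carries only a ring structure and a scaling operation s, so
    that it may have the zero ring as a factor: an empty family of copies of the
    base field occurs when there is no matrix F. *)
Lemma alg_isom_of_embedding (K : fieldType) (aT : falgType K)
    (A : {aspace aT}) (B : pzRingType) (s : K -> B -> B) (f : B -> aT) :
    injective f -> {morph f : a b / a + b} -> {morph f : a b / a * b} ->
    (forall k b, f (s k b) = k *: f b) ->
    (forall u, u \in A <-> exists b, f b = u) ->
  exists g : {lrmorphism subvs_of A -> B | s}, bijective g.
Proof.
move=> f_inj fD fM fZ fA.
have ex_inv (a : subvs_of A) : exists b, f b == vsval a.
  by have [b <-] := (fA (vsval a)).1 (subvsP a); exists b.
pose g a := xchoose (ex_inv a).
have gK a : f (g a) = vsval a by apply/eqP/(xchooseP (ex_inv a)).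
have gD : {morph g : a b / a + b}.
  by move=> a b; apply: f_inj; rewrite fD !gK linearD.
have gM : {morph g : a b / a * b}.
  by move=> a b; apply: f_inj; rewrite fM !gK.
have gZ : scalable_for s g.
  by move=> k a; apply: f_inj; rewrite fZ !gK linearZ.
have gP b : exists a, g a = b.
  have Ab : f b \in A by apply/fA; exists b.
  by exists (Subvs Ab); apply: f_inj; rewrite gK.
have g0 : g 0 = 0 by apply: (addrI (g 0)); rewrite -gD !addr0.
(* A multiplicative surjection maps the identity to an identity. *)
have g1 : g 1 = 1.
  by have [a ga] := gP 1; rewrite -[LHS]mulr1 -ga -gM mul1r.
pose h : {lrmorphism subvs_of A -> B | s} := HB.pack g
  (GRing.isNmodMorphism.Build _ _ g (g0, gD))
  (GRing.isMonoidMorphism.Build _ _ g (g1, gM))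
  (GRing.isScalable.Build _ _ _ s g gZ).
exists h; exists (fun b => sval (sig_eqW (gP b))) => [a|b].
  case: (sig_eqW _) => a' /= ga'; apply: val_inj.
  by rewrite /= -[LHS]gK ga' gK.
by case: (sig_eqW _).
Qed.

Lemma scale_injr (K : fieldType) (V : lmodType K) (v : V) :
  v != 0 -> injective (fun k : K => k *: v).
Proof.
move=> v0 k k' /eqP; rewrite -subr_eq0 -scalerBl scaler_eq0 (negPf v0) orbF.
by rewrite subr_eq0 => /eqP.
Qed.

Section MatrixUnits.
Variables (K : fieldType) (aT : falgType K) (I W : finType).
Variables (G : I -> I -> aT) (F : W -> aT).

Hypothesis GG : forall r s t u, G r s * G t u = (s == t)%:R *: G r u.
Hypothesis G_neq0 : forall r, G r r != 0.
Hypothesis FF : forall w w', F w * F w' = (w == w')%:R *: F w.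
Hypothesis F_neq0 : forall w, F w != 0.
Hypothesis GF : forall r s w, G r s * F w = 0.
Hypothesis FG : forall r s w, F w * G r s = 0.

Definition unit_comb (c : I -> I -> K) : aT := \sum_r \sum_s c r s *: G r s.
Definition idem_comb (c : W -> K) : aT := \sum_w c w *: F w.

Local Notation U := <<[seq G w.1 w.2 | w : I * I]>>%VS.
Local Notation V := <<[seq F w | w : W]>>%VS.

Lemma mem_unit_span u : u \in U <-> exists c, u = unit_comb c.
Proof.
split=> [/(mem_span_image (fun w => G w.1 w.2))[c ->] | [c ->]].
  exists (fun r s => c (r, s)); rewrite /unit_comb pair_bigA.
  by apply: eq_bigr => -[].
apply/(mem_span_image (fun w => G w.1 w.2)).
by exists (fun w => c w.1 w.2); rewrite /unit_comb pair_bigA.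
Qed.

Lemma unit_combD c c' :
  unit_comb c + unit_comb c' = unit_comb (fun r s => c r s + c' r s).
Proof.
rewrite -big_split; apply: eq_bigr => r _ /=; rewrite -big_split /=.
by apply: eq_bigr => s _; rewrite -scalerDl.
Qed.

Lemma unit_combZ a c : unit_comb (fun r s => a * c r s) = a *: unit_comb c.
Proof.
rewrite scaler_sumr; apply: eq_bigr => r _; rewrite scaler_sumr.
by apply: eq_bigr => s _; rewrite scalerA.
Qed.

Lemma idem_combD b b' :
  idem_comb b + idem_comb b' = idem_comb (fun w => b w + b' w).
Proof. by rewrite -big_split; apply: eq_bigr => w _ /=; rewrite -scalerDl. Qed.

Lemma idem_combZ a b : idem_comb (fun w => a * b w) = a *: idem_comb b.
Proof. by rewrite scaler_sumr; apply: eq_bigr => w _; rewrite scalerA. Qed.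

Lemma eq_unit_comb c c' : c =2 c' -> unit_comb c = unit_comb c'.
Proof. by move=> E; apply: eq_bigr => r _; apply: eq_bigr => s _; rewrite E. Qed.

Lemma eq_idem_comb b b' : b =1 b' -> idem_comb b = idem_comb b'.
Proof. by move=> E; apply: eq_bigr => w _; rewrite E. Qed.

Lemma unit_combM c c' :
  unit_comb c * unit_comb c' = unit_comb (fun r u => \sum_s c r s * c' s u).
Proof.
rewrite /unit_comb mulr_suml; apply: eq_bigr => r _; rewrite mulr_suml.
under [RHS]eq_bigr => u _ do rewrite scaler_suml.
rewrite [RHS]exchange_big; apply: eq_bigr => s _ /=.
rewrite mulr_sumr (bigD1 s) //= [X in _ + X]big1 ?addr0 => [|t /negPf ts].
  rewrite mulr_sumr; apply: eq_bigr => u _.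
  by rewrite -scalerAl -scalerAr GG eqxx scale1r scalerA.
rewrite mulr_sumr big1 // => u _.
by rewrite -scalerAl -scalerAr GG eq_sym ts scale0r !scaler0.
Qed.

Lemma idem_combM c c' :
  idem_comb c * idem_comb c' = idem_comb (fun w => c w * c' w).
Proof.
rewrite /idem_comb mulr_suml; apply: eq_bigr => w _.
rewrite mulr_sumr (bigD1 w) //= [X in _ + X]big1 ?addr0 => [|t /negPf tw].
  by rewrite -scalerAl -scalerAr FF eqxx scale1r scalerA.
by rewrite -scalerAl -scalerAr FF eq_sym tw scale0r !scaler0.
Qed.

Lemma unit_combF c w : unit_comb c * F w = 0.
Proof.
rewrite mulr_suml big1 // => r _; rewrite mulr_suml big1 // => s _.
by rewrite -scalerAl GF scaler0.
Qed.

Lemma F_unit_comb c w : F w * unit_comb c = 0.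
Proof.
rewrite mulr_sumr big1 // => r _; rewrite mulr_sumr big1 // => s _.
by rewrite -scalerAr FG scaler0.
Qed.

Lemma unit_comb_idem_comb c c' : unit_comb c * idem_comb c' = 0.
Proof. by rewrite mulr_sumr big1 // => w _; rewrite -scalerAr unit_combF scaler0. Qed.

Lemma idem_comb_unit_comb c c' : idem_comb c' * unit_comb c = 0.
Proof. by rewrite mulr_suml big1 // => w _; rewrite -scalerAl F_unit_comb scaler0. Qed.

Lemma F_idem_comb c w : F w * idem_comb c = c w *: F w.
Proof.
rewrite mulr_sumr (bigD1 w) //= big1 ?addr0 => [|t /negPf tw].
  by rewrite -scalerAr FF eqxx scale1r.
by rewrite -scalerAr FF eq_sym tw scale0r scaler0.
Qed.

Lemma idem_combF c w : idem_comb c * F w = c w *: F w.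
Proof.
rewrite mulr_suml (bigD1 w) //= big1 ?addr0 => [|t /negPf tw].
  by rewrite -scalerAl FF eqxx scale1r.
by rewrite -scalerAl FF tw scale0r scaler0.
Qed.

(** Multiplying by matrix units on both sides reads off one coefficient; this is
    what makes the matrix units linearly independent. *)
Lemma G_unit_comb_G c r s : G r r * unit_comb c * G s r = c r s *: G r r.
Proof.
rewrite mulr_sumr mulr_suml (bigD1 r) //= [X in _ + X]big1 ?addr0 => [|t /negPf tr].
  rewrite mulr_sumr mulr_suml (bigD1 s) //= [X in _ + X]big1 ?addr0 => [|t /negPf ts].
    by rewrite -scalerAr -scalerAl !GG eqxx scale1r GG eqxx scale1r.
  by rewrite -scalerAr -scalerAl !GG eqxx scale1r GG ts scale0r scaler0.
rewrite mulr_sumr mulr_suml big1 // => t' _.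
by rewrite -scalerAr GG eq_sym tr scale0r scaler0 mul0r.
Qed.

Lemma comb_inj c c' b b' :
  unit_comb c + idem_comb b = unit_comb c' + idem_comb b' ->
  c =2 c' /\ b =1 b'.
Proof.
move=> E; split=> [r s | w].
  apply: (scale_injr (G_neq0 r)).
  have := congr1 (fun v => G r r * v * G s r) E.
  rewrite !mulrDr !mulrDl !G_unit_comb_G.
  have GFG b0 : G r r * idem_comb b0 * G s r = 0.
    rewrite mulr_sumr mulr_suml big1 // => w _.
    by rewrite -scalerAr GF scaler0 mul0r.
  by rewrite !GFG !addr0.
apply: (scale_injr (F_neq0 w)).
have := congr1 (fun v => F w * v) E.
by rewrite !mulrDr !F_unit_comb !F_idem_comb !add0r.
Qed.

Lemma mem_comb u :
  u \in (U + V)%VS <-> exists c b, u = unit_comb c + idem_comb b.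
Proof.
split=> [/memv_addP[a /mem_unit_span[c ->] [b /mem_span_image[b' ->] ->]]|].
  by exists c, b'.
case=> c [b ->]; apply: memv_add; first by apply/mem_unit_span; exists c.
by apply/mem_span_image; exists b.
Qed.

Lemma comb_mul c b c' b' :
  (unit_comb c + idem_comb b) * (unit_comb c' + idem_comb b')
  = unit_comb (fun r u => \sum_s c r s * c' s u) + idem_comb (fun w => b w * b' w).
Proof.
by rewrite mulrDl !mulrDr unit_comb_idem_comb idem_comb_unit_comb
  unit_combM idem_combM addr0 add0r.
Qed.

Lemma comb_span_mul_closed : ((U + V) * (U + V) <= U + V)%VS.
Proof.
apply/prodvP=> _ _ /mem_comb[c [b ->]] /mem_comb[c' [b' ->]].
by rewrite comb_mul; apply/mem_comb; do 2!eexists.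
Qed.

Lemma unit_span_mul_closed : (U * U <= U)%VS.
Proof.
apply/prodvP=> _ _ /mem_unit_span[c ->] /mem_unit_span[c' ->].
by rewrite unit_combM; apply/mem_unit_span; eexists.
Qed.

(** The identity element is the sum of the diagonal matrix units, which in
    general is not the identity of the ambient algebra. *)
Lemma unit_span_is_aspace (r0 : I) : is_aspace U.
Proof.
rewrite /is_aspace unit_span_mul_closed andbT; apply/has_algidP.
pose delta (r s : I) : K := (r == s)%:R.
have del_l (c : I -> I -> K) : (fun r s => \sum_t delta r t * c t s) =2 c.
  move=> r s; rewrite (bigD1 r) //= /delta eqxx mul1r big1 ?addr0 // => t.
  by rewrite eq_sym => /negPf->; rewrite mul0r.
have del_r (c : I -> I -> K) : (fun r s => \sum_t c r t * delta t s) =2 c.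
  move=> r s; rewrite (bigD1 s) //= /delta eqxx mulr1 big1 ?addr0 // => t.
  by move=> /negPf->; rewrite mulr0.
exists (unit_comb delta); split; first by apply/mem_unit_span; eexists.
  apply: contraNneq (G_neq0 r0) => d0; have := G_unit_comb_G delta r0 r0.
  by rewrite d0 mulr0 mul0r /delta eqxx scale1r => <-.
by move=> _ /mem_unit_span[c ->]; rewrite !unit_combM (eq_unit_comb (del_l c))
  (eq_unit_comb (del_r c)).
Qed.

Section Algebra.

Variable T : {aspace aT}.
Hypothesis T_span : (T : {vspace aT}) = (U + V)%VS.

Lemma unit_span_ideal : is_ideal T U.
Proof.
rewrite /is_ideal T_span addvSl /=; apply/andP; split; apply/prodvP.
  move=> _ _ /mem_comb[c [b ->]] /mem_unit_span[c' ->].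
  by rewrite mulrDl idem_comb_unit_comb addr0 unit_combM; apply/mem_unit_span; eexists.
move=> _ _ /mem_unit_span[c' ->] /mem_comb[c [b ->]].
by rewrite mulrDr unit_comb_idem_comb addr0 unit_combM; apply/mem_unit_span; eexists.
Qed.

(** The idempotents commute with one another, so a commutator in T only has a
    component along the matrix units. *)
Lemma quotient_commutative : commutative (@alg_quot_mul _ _ T U).
Proof.
move=> a b; rewrite /alg_quot_mul.
set x := repr a; set y := repr b; apply/eqP.
rewrite -(Quotient.idealrBE (vs_ideal U : zmodClosed (subvs_of T))).
rewrite unfold_in linearB /=.
have [c [f ->]] : exists c f, vsval x = unit_comb c + idem_comb f.
  by apply/mem_comb; rewrite -T_span subvsP.
have [c' [f' ->]] : exists c f, vsval y = unit_comb c + idem_comb f.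
  by apply/mem_comb; rewrite -T_span subvsP.
rewrite !comb_mul [in X in _ - X](_ : idem_comb _ = idem_comb (fun w => f w * f' w)).
  by rewrite opprD addrACA subrr addr0 rpredB //; apply/mem_unit_span; eexists.
by apply: eq_bigr => w _; rewrite mulrC.
Qed.

Lemma F_central w : F w \in 'Z(T)%VS.
Proof.
rewrite memv_cap T_span memvE (subv_trans _ (addvSr _ _)) -?memvE ?memv_span ?image_f //=.
apply/centvP=> _ /mem_comb[c [b ->]].
by rewrite mulrDr mulrDl F_unit_comb unit_combF F_idem_comb idem_combF.
Qed.

Lemma F_ideal w : is_ideal T <[F w]>%VS.
Proof.
have FT : F w \in T by have := F_central w; rewrite memv_cap => /andP[].
rewrite /is_ideal -memvE FT /= T_span; apply/andP; split; apply/prodvP.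
  move=> _ _ /mem_comb[c [b ->]] /vlineP[k ->].
  by rewrite -scalerAr mulrDl unit_combF add0r idem_combF scalerA memvZ ?memv_line.
move=> _ _ /vlineP[k ->] /mem_comb[c [b ->]].
by rewrite -scalerAl mulrDr F_unit_comb add0r F_idem_comb scalerA memvZ ?memv_line.
Qed.

End Algebra.

Section Isomorphisms.

Variables (n m : nat) (e : I -> 'I_n) (k : W -> 'I_m).
Hypotheses (e_bij : bijective e) (k_bij : bijective k).

(** Numbering the indices turns the convolution of coefficients into the matrix
    product. *)
Lemma unit_comb_mulmx (B B' : 'M[K]_n) :
  unit_comb (fun r u => \sum_s B (e r) (e s) * B' (e s) (e u))
  = unit_comb (fun r s => (B *m B') (e r) (e s)).
Proof.
apply: eq_bigr => r _; apply: eq_bigr => s _; congr (_ *: _).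
by rewrite mxE (reindex e) //; apply: onW_bij.
Qed.

Lemma unit_comb_matrix c : exists B : 'M[K]_n, c =2 fun r s => B (e r) (e s).
Proof.
have [g eK gK] := e_bij.
by exists (\matrix_(i, j) c (g i) (g j)) => r s; rewrite mxE !eK.
Qed.

Lemma unit_span_isom (A : {aspace aT}) :
  (A : {vspace aT}) = U -> alg_isom (subvs_of A) 'M[K]_n.
Proof.
move=> A_U; pose f (B : 'M[K]_n) := unit_comb (fun r s => B (e r) (e s)).
have [g eK gK] := e_bij.
apply: (@alg_isom_of_embedding _ _ A 'M[K]_n *:%R f).
- move=> B B' E; apply/matrixP=> i j; rewrite -(gK i) -(gK j).
  have E0 : f B + idem_comb (fun=> 0) = f B' + idem_comb (fun=> 0) by rewrite E.
  exact: (comb_inj E0).1.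
- by move=> B B'; rewrite /f unit_combD; apply: eq_unit_comb => r s; rewrite mxE.
- by move=> B B'; rewrite /f unit_combM unit_comb_mulmx.
- by move=> a B; rewrite /f -unit_combZ; apply: eq_unit_comb => r s; rewrite mxE.
move=> u; rewrite A_U mem_unit_span; split=> [[c ->]|[B <-]]; last by eexists.
have [B cB] := unit_comb_matrix c.
by exists B; rewrite /f (eq_unit_comb cB).
Qed.

Lemma comb_span_isom (T : {aspace aT}) : (T : {vspace aT}) = (U + V)%VS ->
  alg_isom (subvs_of T) ('M[K]_n * {ffun 'I_m -> 'M[K]_1})%type.
Proof.
move=> T_span; have [g eK gK] := e_bij; have [l kK lK] := k_bij.
pose f (B : 'M[K]_n * {ffun 'I_m -> 'M[K]_1}) :=
  unit_comb (fun r s => B.1 (e r) (e s)) + idem_comb (fun w => B.2 (k w) 0 0).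
refine (@alg_isom_of_embedding _ _ T _ _ f _ _ _ _ _).
- move=> [B b] [B' b'] /comb_inj[/= E1 E2]; congr (_, _).
    by apply/matrixP=> i j; rewrite -(gK i) -(gK j) E1.
  by apply/ffunP=> i; apply/matrixP=> j0 j1; rewrite !ord1 -(lK i) E2.
- move=> [B b] [B' b']; rewrite /f /= addrACA unit_combD idem_combD.
  congr (_ + _); first by apply: eq_unit_comb => r s; rewrite mxE.
  by apply: eq_idem_comb => w; rewrite ffunE mxE.
- move=> [B b] [B' b']; rewrite /f /= comb_mul unit_comb_mulmx.
  congr (_ + _); apply: eq_idem_comb => w.
  by rewrite ffunE mxE big_ord1.
- move=> a [B b]; rewrite /f /= scalerDr -unit_combZ -idem_combZ.
  congr (_ + _); first by apply: eq_unit_comb => r s; rewrite mxE.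
  by apply: eq_idem_comb => w; rewrite ffunE mxE.
move=> u; rewrite T_span mem_comb.
split=> [[c [b ->]]|[[B b] <-]]; last by do 2!eexists.
have [B cB] := unit_comb_matrix c.
exists (B, [ffun i => const_mx (b (l i))]); rewrite /f /= (eq_unit_comb cB).
by congr (_ + _); apply: eq_idem_comb => w; rewrite ffunE mxE kK.
Qed.

End Isomorphisms.

End MatrixUnits.

(** * Roots of unity and characters of cyclic groups *)

Section RootsOfUnity.
Variable R : realType.
Local Notation C := R[i].

Lemma root_of_unityX n k : (Defs.root_of_unity R n) ^+ k =
  (cos (k%:R * (2 * pi / n%:R)) +i* sin (k%:R * (2 * pi / n%:R)))%C.
Proof.
elim: k => [|k IHk]; first by rewrite expr0 mul0r cos0 sin0.
rewrite exprSr IHk /Defs.root_of_unity; set t := 2 * pi / n%:R.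
have -> : k.+1%:R * t = k%:R * t + t by rewrite -natr1 mulrDl mul1r.
by rewrite cosD sinD; congr (_ +i* _)%C; rewrite addrC.
Qed.

(** If the power k < n of the root were 1, the cosine of 2 pi k / n would be 1,
    whereas it is 1 - 2 sin^2 (pi k / n) and the sine is positive on the open
    interval from 0 to pi. *)
Lemma root_of_unity_primitive n :
  (0 < n)%N -> n.-primitive_root (Defs.root_of_unity R n).
Proof.
move=> n_gt0; rewrite /primitive_root_of_unity n_gt0; apply/forallP=> k.
have n_neq0 : n%:R != 0 :> R by rewrite pnatr_eq0 -lt0n.
rewrite unity_rootE root_of_unityX; apply/eqP.
have [->|k_neq] := eqVneq k.+1 n.
  by rewrite mulrC divfK // mulr_natl cos2pi sin2pi; apply/eqP.
apply/negbTE/eqP => -[cos1 _].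
have lt_kn : (k.+1 < n)%N by rewrite ltn_neqAle k_neq ltn_ord.
have E : k.+1%:R * (2 * pi / n%:R) = (k.+1%:R * pi / n%:R) *+ 2 :> R.
  by rewrite -mulr_natl; ring.
have : 0 < sin (k.+1%:R * pi / n%:R : R).
  apply: sin_gt0_pi; rewrite divr_gt0 ?mulr_gt0 ?pi_gt0 ?ltr0n //=.
  by rewrite ltr_pdivrMr ?ltr0n // mulrC ltr_pM2l ?pi_gt0 // ltr_nat.
move: cos1; rewrite E cos_mulr2n cos2sin2 => cos1 sin_gt0.
have : sin (k.+1%:R * pi / n%:R : R) ^+ 2 > 0 by rewrite exprn_gt0.
by lra.
Qed.

End RootsOfUnity.

Section Fourier.
Variables (K : fieldType) (n : nat) (z : K).
Hypothesis z_prim : n.-primitive_root z.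

Lemma prim_root_neq0 : z != 0.
Proof.
have n_gt0 := prim_order_gt0 z_prim.
apply/eqP=> z0; have /eqP := prim_expr_order z_prim.
by rewrite z0 expr0n gtn_eqF // eq_sym oner_eq0.
Qed.

Lemma sum_unity_root (q : K) : q ^+ n = 1 -> \sum_(a < n) q ^+ a = (q == 1)%:R * n%:R.
Proof.
move=> qn1; have [->|q_neq1] := eqVneq q 1.
  by under eq_bigr do rewrite expr1n; rewrite sumr_const card_ord mul1r.
have /eqP := subrX1 q n; rewrite qn1 subrr eq_sym mulf_eq0 subr_eq0 (negPf q_neq1) /=.
by rewrite mul0r => /eqP.
Qed.

Lemma prim_expXn k : (z ^+ k) ^+ n = 1.
Proof. by rewrite exprAC (prim_expr_order z_prim) expr1n. Qed.

Lemma prim_expI (a b : 'I_n) : (z ^+ a / z ^+ b == 1) = (a == b).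
Proof.
rewrite -subr_eq0 -[X in _ - X](divff (expf_neq0 b prim_root_neq0)) -mulrBl mulf_eq0.
rewrite invr_eq0 (negPf (expf_neq0 b prim_root_neq0)) orbF subr_eq0.
by rewrite (eq_prim_root_expr z_prim) !modn_small.
Qed.

Lemma char_orthogonal xi xi' : (xi < n)%N -> (xi' < n)%N ->
  \sum_(a < n) z ^+ (a * xi) / z ^+ (a * xi') = (xi == xi')%:R * n%:R.
Proof.
move=> lt_xi lt_xi'; rewrite -[xi == xi']/(Ordinal lt_xi == Ordinal lt_xi') -prim_expI /=.
rewrite -sum_unity_root ?expr_div_n ?prim_expXn ?divr1 //.
by apply: eq_bigr => a _; rewrite expr_div_n -!exprM ![(_ * a)%N]mulnC.
Qed.

Lemma sum_char xi : (0 < xi < n)%N -> \sum_(a < n) z ^+ (a * xi) = 0.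
Proof.
case/andP=> xi_gt0 lt_xi; have := char_orthogonal lt_xi (prim_order_gt0 z_prim).
rewrite gtn_eqF // mul0r => E; rewrite -[RHS]E.
by apply: eq_bigr => a _; rewrite muln0 divr1.
Qed.

Lemma sum_charV xi : (0 < xi < n)%N -> \sum_(a < n) (z ^+ (a * xi))^-1 = 0.
Proof.
case/andP=> xi_gt0 lt_xi; have := char_orthogonal (prim_order_gt0 z_prim) lt_xi.
rewrite ltn_eqF // mul0r => E; rewrite -[RHS]E.
by apply: eq_bigr => a _; rewrite muln0 div1r.
Qed.

Lemma fourier_inversion (a b c : 'I_n) :
  \sum_(xi < n) z ^+ (b * xi) / z ^+ (a * xi) / z ^+ (c * xi)
  = (b == (a + c) %% n :> nat)%N%:R * n%:R.
Proof.
have n_gt0 := prim_order_gt0 z_prim.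
(* Inversion is orthogonality of characters with the roles of the group and of
   its dual exchanged. *)
pose ac := Ordinal (ltn_pmod (a + c) n_gt0).
rewrite -[_ == _ :> nat]/(b == ac :> nat) -char_orthogonal //; apply: eq_bigr => xi _.
have -> : z ^+ (xi * ac) = z ^+ (a * xi) * z ^+ (c * xi).
  rewrite -exprD -mulnDl [(xi * ac)%N]mulnC; apply/eqP.
  by rewrite (eq_prim_root_expr z_prim) /= modnMml.
by rewrite invfM mulrA [(xi * b)%N]mulnC.
Qed.

(** Only the term whose shift takes a to b is nonzero.  The sum appears in this
    split form, with the shift 0 apart, in the middle factor of the matrices
    F. *)
Lemma sum_shift_delta (a b : 'I_n) xi :
  (a == b)%:R + \sum_(k < n.-1) z ^+ (k.+1 * xi) * (b == (a + k.+1) %% n :> nat)%N%:R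
  = z ^+ (b * xi) / z ^+ (a * xi).
Proof.
have n_gt0 := prim_order_gt0 z_prim.
have -> : (a == b)%:R = z ^+ (0 * xi) * (b == (a + 0) %% n :> nat)%N%:R.
  by rewrite mul0n expr0 mul1r addn0 modn_small // eq_sym.
pose f k := z ^+ (k * xi) * (b == (a + k) %% n :> nat)%N%:R.
rewrite -[_ + _](big_ord_recl n.-1 (fun k => f k)).
rewrite -(big_mkord xpredT f) prednK //.
rewrite big_mkord; apply: (mulIf (expf_neq0 (a * xi) prim_root_neq0)).
rewrite divfK ?expf_neq0 ?prim_root_neq0 // mulr_suml.
have lt_k : ((b + (n - a)) %% n < n)%N by rewrite ltn_pmod.
rewrite (bigD1 (Ordinal lt_k)) //= big1 ?addr0 => [|k k_neq].
  rewrite /f modnDmr addnCA subnKC 1?ltnW // modnDr (modn_small (ltn_ord b)) eqxx mulr1.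
  rewrite -exprD -mulnDl; apply/eqP; rewrite (eq_prim_root_expr z_prim).
  by rewrite -modnMml modnDml -addnA subnK 1?ltnW // modnDr modnMml.
rewrite /f; case: eqP => [E|]; last by rewrite mulr0 mul0r.
case/eqP: k_neq; apply: val_inj => /=; rewrite E.
by rewrite modnDml -addnA addnCA subnKC 1?ltnW // modnDr modn_small.
Qed.

End Fourier.

(** * Vertices and blocks of the wreath product of cyclic schemes *)

Section Blocks.
Variables (d : nat) (p : 'I_d -> nat).
Local Notation X := (vertex p).
Local Notation rel_ := (@cyclic_wreath d p).

(** The union of the relations of level at most m; its classes are the fibres of
    the projection that forgets the coordinates below m. *)
Definition agree (m : nat) (y z : X) :=
  [forall j : 'I_d, (m <= j)%N ==> (y j == z j)].

Definition width (m : nat) : nat := (\prod_(j < d | j < m) p j)%N.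

Lemma agreeP m (y z : X) :
  reflect (forall j : 'I_d, (m <= j)%N -> y j = z j) (agree m y z).
Proof.
apply: (iffP forallP) => E j; last by apply/implyP => /E->.
by move=> mj; apply/eqP; move: (E j); rewrite mj.
Qed.

Lemma agree_refl m y : agree m y y. Proof. by apply/agreeP. Qed.

Lemma agree_sym m y z : agree m y z = agree m z y.
Proof. by apply/agreeP/agreeP => E j /E. Qed.

Lemma agree_transl m y w z : agree m y w -> agree m y z = agree m w z.
Proof.
move=> /agreeP yw; apply/agreeP/agreeP => E j mj; first by rewrite -yw ?E.
by rewrite yw ?E.
Qed.

Lemma agree_mono m m' y z : (m <= m')%N -> agree m y z -> agree m' y z.
Proof. by move=> mm' /agreeP E; apply/agreeP => j /(leq_trans mm')/E. Qed.

Lemma agree0 y z : agree 0 y z = (y == z).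
Proof.
apply/agreeP/eqP => [E|-> //]; by apply/ffunP => j; apply: E.
Qed.

Lemma agreeS (h : 'I_d) y z : agree h y z = agree h.+1 y z && (y h == z h).
Proof.
apply/agreeP/andP => [E|[/agreeP E /eqP yz] j].
  by split; [apply/agreeP => j /ltnW/E | apply/eqP/E].
by rewrite leq_eqVlt => /predU1P[/val_inj<-|/E].
Qed.

Lemma card_agree m y : #|[pred w | agree m y w]| = width m.
Proof.
pose F (j : 'I_d) : pred 'I_(p j) := if (m <= j)%N then pred1 (y j) else predT.
have -> : #|[pred w | agree m y w]| = #|(family F : simpl_pred X)|; last first.
  rewrite card_family foldrE big_map big_enum /= /width [RHS]big_mkcond /=.
  by apply: eq_bigr => j _; rewrite /F ltnNge; case: (m <= j)%N; rewrite ?card1 ?card_ord.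
apply: eq_card => w; rewrite !inE; apply/agreeP/familyP => E j; have := E j.
  by rewrite /F; case: (m <= j)%N => // ->; rewrite ?inE.
by rewrite /F; case: (m <= j)%N => // /eqP->.
Qed.

(** Each value of the coordinate h is taken equally often in the class, once for
    each choice of the coordinates below h. *)
Lemma sum_agree (V : nmodType) (h : 'I_d) (y : X) (f : 'I_(p h) -> V) :
  \sum_(w | agree h.+1 y w) f (w h) = (\sum_a f a) *+ width h.
Proof.
rewrite (partition_big (fun w : X => w h) xpredT) //= -sumrMnl.
apply: eq_bigr => a _.
pose y' : X := [ffun j => dfwith (fun j => y j) a j].
rewrite -(card_agree h y') -sumr_const.
apply: eq_big => [w|w /andP[_ /eqP->] //].
rewrite !inE agreeS eq_sym /y' ffunE dfwith_in; congr (_ && _).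
apply/agreeP/agreeP => E j hj; have := E j hj; rewrite ffunE dfwith_out //;
  by rewrite neq_ltn hj.
Qed.

Lemma widthS (h : 'I_d) : width h.+1 = (p h * width h)%N.
Proof.
rewrite /width (bigD1 h) //=; congr (_ * _)%N; apply: eq_bigl => j.
by rewrite ltnS -val_eqE /= andbC -ltn_neqAle.
Qed.

Lemma cyclic_relN (n k : nat) (a : 'I_n) : (k < n.-1)%N -> ~~ cyclic_rel k.+1 a a.
Proof.
move=> lt_k; have n_gt0 : (0 < n)%N by apply: leq_trans (ltn_ord a).
rewrite /cyclic_rel -{1}(modn_small (ltn_ord a)) -{1}[nat_of_ord a]addn0 eqn_modDl mod0n.
by rewrite modn_small // -(prednK n_gt0) ltnS.
Qed.

(** The level of a relation is the number of coordinates, from the bottom, up to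
    the last one at which a related pair differs. *)
Lemma cyclic_wreath_agree r (y z : X) m :
  rel_ r y z -> (level r <= m)%N = agree m y z.
Proof.
case: r => [u|] /=; last by move/eqP->; rewrite agree_refl.
case/andP=> above at_u; have [lt_um|le_mu] := ltnP.
  by rewrite (agree_mono lt_um).
apply/esym/negbTE/agreeP => /(_ _ le_mu) yz.
by move: at_u; rewrite yz (negPf (cyclic_relN _ (ltn_ord _))).
Qed.

Lemma cyclic_rel_exists n (a b : 'I_n) :
  a != b -> exists k : 'I_n.-1, cyclic_rel k.+1 a b.
Proof.
move=> ab; have n_gt0 : (0 < n)%N by apply: leq_trans (ltn_ord a).
pose k := ((b + (n - a)) %% n)%N.
have kE : ((a + k) %% n)%N = b.
  by rewrite modnDmr addnCA subnKC 1?ltnW // modnDr modn_small.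
have k_gt0 : (0 < k)%N.
  rewrite lt0n; apply: contraNneq ab => k0; apply/eqP/val_inj.
  by rewrite -[RHS]kE k0 addn0 modn_small.
have lt_k : (k.-1 < n.-1)%N by rewrite -ltnS !prednK // ltn_pmod.
by exists (Ordinal lt_k); rewrite /cyclic_rel /= prednK // kE.
Qed.

Lemma cyclic_rel_inj n (a b : 'I_n) (k k' : 'I_n.-1) :
  cyclic_rel k.+1 a b -> cyclic_rel k'.+1 a b -> k = k'.
Proof.
have n_gt0 : (0 < n)%N by apply: leq_trans (ltn_ord a).
rewrite /cyclic_rel => /eqP->; rewrite eqn_modDl !modn_small ?eqSS; last 2 first.
- by rewrite -{2}(prednK n_gt0) ltnS.
- by rewrite -{2}(prednK n_gt0) ltnS.
by move=> /eqP/val_inj.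
Qed.

Lemma cyclic_wreath_exists (y z : X) : exists r, rel_ r y z.
Proof.
have [->|/eqP yz] := eqVneq y z; first by exists None => /=.
have [i0 yz0] : exists i, y i != z i.
  apply/existsP; apply: contra_notT yz; rewrite negb_exists => /forallP E.
  by apply/ffunP => i; apply/eqP; have := E i; rewrite negbK.
case: (@arg_maxnP _ i0 (fun i => y i != z i) (fun i => i) yz0) => i yzi max_i.
have [k yzk] := cyclic_rel_exists yzi.
exists (Some (Tagged (fun i => 'I_(p i).-1) k)) => /=; rewrite yzk andbT.
apply/(agreeP i.+1) => j; rewrite ltnNge; apply: contraNeq => /max_i.
exact.
Qed.

Lemma cyclic_wreath_inj r s (y z : X) : rel_ r y z -> rel_ s y z -> r = s.
Proof.
move=> yzr yzs.
have lev : level r = level s.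
  by apply/eqP; rewrite eqn_leq (cyclic_wreath_agree _ yzr) (cyclic_wreath_agree _ yzs)
    -(cyclic_wreath_agree _ yzs) -(cyclic_wreath_agree _ yzr) !leqnn.
case: r s yzr yzs lev => [[i k]|] [[i' k']|] //= /andP[_ yzk] /andP[_ yzk'] [/val_inj E].
move: k' yzk'; rewrite -E => k' yzk'.
by rewrite (cyclic_rel_inj yzk yzk').
Qed.

(** The relations partition the pairs of vertices. *)
Lemma sum_rel (S : pzSemiRingType) (P : pred (option (label p))) r (y z : X) :
  rel_ r y z -> \sum_(s | P s) (rel_ s y z)%:R = (P r)%:R :> S.
Proof.
move=> yz; rewrite (big_rem r) ?mem_index_enum //= yz big1_seq ?addr0 => [|s].
  by case: (P r).
rewrite mem_rem_uniq ?index_enum_uniq // inE => /andP[_ /andP[/eqP s_neq _]].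
by case ys: (rel_ s y z) => //; case: s_neq; apply: cyclic_wreath_inj ys yz.
Qed.

Lemma sum_level (S : pzSemiRingType) m (y z : X) :
  \sum_(r | (level r <= m)%N) (rel_ r y z)%:R = (agree m y z)%:R :> S.
Proof.
have [r yz] := cyclic_wreath_exists y z.
by rewrite (sum_rel _ _ yz) (cyclic_wreath_agree _ yz).
Qed.

Variable x : X.

Lemma block_exists r : exists y, rel_ r x y.
Proof.
case: r => [[i k]|]; last by exists x => /=.
have n_gt0 : (0 < p i)%N by apply: leq_trans (ltn_ord (x i)).
pose b := Ordinal (ltn_pmod (x i + k.+1) n_gt0).
exists [ffun j => dfwith (fun j => x j) b j] => /=; apply/andP; split.
  apply/(agreeP i.+1) => j ij; rewrite ffunE dfwith_out //.
  by rewrite neq_ltn ij.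
by rewrite ffunE dfwith_in /cyclic_rel.
Qed.

(** For r = None the truncated predecessor makes the class a singleton, which is
    the right block. *)
Lemma blockE r (y w : X) : rel_ r x y -> rel_ r x w = agree (level r).-1 y w.
Proof.
case: r => [u|] /=; last by move/eqP<-; rewrite agree0.
case/andP=> /(agree_transl) above /eqP at_u.
rewrite -[[forall j, _]]/(agree (tag u).+1 x w) above agreeS.
by rewrite /cyclic_rel -at_u eq_sym.
Qed.

Lemma block_agree r m (y w : X) :
  (m < level r)%N -> agree m y w -> rel_ r x y = rel_ r x w.
Proof.
move=> lt_m yw; have [s xy] := cyclic_wreath_exists x y.
have le_m : (m <= (level r).-1)%N by rewrite -ltnS (ltn_predK lt_m).
apply/idP/idP => [xry|xrw].
  by rewrite (blockE _ xry) (agree_mono le_m).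
by rewrite (blockE _ xrw) agree_sym (agree_mono le_m).
Qed.

Lemma rel_agree (u : label p) (y y' z z' : X) :
  agree (tag u) y y' -> agree (tag u) z z' ->
  rel_ (Some u) y z = rel_ (Some u) y' z'.
Proof.
move=> yy' zz' /=; set l := tag u in yy' zz' *.
have [yy'S zz'S] := (agree_mono (leqnSn l) yy', agree_mono (leqnSn l) zz').
rewrite -[[forall j, _]]/(agree l.+1 y z) -[X in _ = X && _]/(agree l.+1 y' z').
rewrite -(agree_transl _ yy'S) (agree_sym _ y z') -(agree_transl _ zz'S) agree_sym.
by rewrite (agreeP _ _ _ yy') // (agreeP _ _ _ zz').
Qed.

(** A relation of tag l that links y to z makes them agree above l.  If one of
    the levels were larger than l.+1, agreement above l would put y and z in the
    same block; so each block lies in a class of agreement at the coordinates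
    >= l, and those coordinates alone decide a relation of tag l. *)
Lemma rel_between_blocks r s k (y y' z z' : X) : r != s ->
    rel_ r x y -> rel_ r x y' -> rel_ s x z -> rel_ s x z' ->
  rel_ k y z -> rel_ k y' z'.
Proof.
move=> /eqP neq_rs xry xry' xsz xsz'.
case: k => [u|/eqP yz]; last by case: neq_rs; apply: cyclic_wreath_inj xry _; rewrite yz.
case/andP; rewrite -[[forall j, _]]/(agree (tag u).+1 y z) => above at_u.
set l := tag u in above at_u.
have level_le q q' v w : rel_ q x v -> rel_ q' x w -> q <> q' ->
    agree l.+1 v w -> ((level q).-1 <= l)%N.
  move=> xqv xqw neq_q vw; rewrite leqNgt; apply/negP=> lt_l; apply: neq_q.
  apply: cyclic_wreath_inj xqw; rewrite -(@block_agree q l.+1 v w) //.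
  by rewrite -ltn_predRL.
have yy' : agree l y y'.
  by rewrite (agree_mono (level_le _ _ _ _ xry xsz neq_rs above)) -?(blockE _ xry).
have zz' : agree l z z'.
  rewrite (agree_mono (level_le _ _ _ _ xsz xry (nesym neq_rs) _)) -?(blockE _ xsz) //.
  by rewrite agree_sym.
by rewrite -(rel_agree yy' zz') /= -[[forall j, _]]/(agree l.+1 y z) above.
Qed.

End Blocks.

(** * Matrices as kernels on the vertices *)

Section Kernels.
Variables (K : fieldType) (X : finType) (x : X).
Local Notation nv := (nth_vertex x).

(** Indexing by vertices instead of ordinals keeps the enumeration of the
    vertices out of all later computations. *)
Definition kernel_mx (f : X -> X -> K) : vmatrix K X :=
  \matrix_(a, b) f (nv a) (nv b).

Lemma nth_vertex_bij : bijective nv.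
Proof.
apply: (@bij_comp _ _ _ enum_val); first exact: enum_val_bij.
by exists (cast_ord (esym (card_pred_vertex x))); [exact: cast_ordK | exact: cast_ordKV].
Qed.

Lemma sum_nth_vertex (V : nmodType) (f : X -> V) : \sum_a f (nv a) = \sum_w f w.
Proof. by rewrite [RHS](reindex nv) //; apply: onW_bij nth_vertex_bij. Qed.

Lemma eq_kernel_mx f g : f =2 g -> kernel_mx f = kernel_mx g.
Proof. by move=> E; apply/matrixP=> a b; rewrite !mxE E. Qed.

Lemma kernel_mx_entry f (y z : X) : kernel_mx f = 0 -> f y z = 0.
Proof.
have [g gK gK'] := nth_vertex_bij.
by move/matrixP/(_ (g y) (g z)); rewrite !mxE !gK'.
Qed.

Lemma kernel_mxM f g :
  kernel_mx f * kernel_mx g = kernel_mx (fun y z => \sum_w f y w * g w z).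
Proof.
apply/matrixP=> a b; rewrite !mxE -sum_nth_vertex.
by apply: eq_bigr => c _; rewrite !mxE.
Qed.

Lemma kernel_mxD f g :
  kernel_mx f + kernel_mx g = kernel_mx (fun y z => f y z + g y z).
Proof. by apply/matrixP=> a b; rewrite !mxE. Qed.

Lemma kernel_mxZ k f : k *: kernel_mx f = kernel_mx (fun y z => k * f y z).
Proof. by apply/matrixP=> a b; rewrite !mxE. Qed.

Lemma kernel_mx0 : kernel_mx (fun _ _ => 0) = 0.
Proof. by apply/matrixP=> a b; rewrite !mxE. Qed.

Lemma kernel_mx_sum (J : finType) (P : pred J) (f : J -> X -> X -> K) :
  \sum_(j | P j) kernel_mx (f j) = kernel_mx (fun y z => \sum_(j | P j) f j y z).
Proof.
by apply/matrixP=> a b; rewrite summxE !mxE; apply: eq_bigr => j _; rewrite mxE.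
Qed.

Lemma kernel_mx_tr f : (kernel_mx f)^T = kernel_mx (fun y z => f z y).
Proof. by apply/matrixP=> a b; rewrite !mxE. Qed.

Lemma all_ones_kernel : all_ones K X = kernel_mx (fun _ _ => 1).
Proof. by apply/matrixP=> a b; rewrite !mxE. Qed.

Lemma one_kernel : 1 = kernel_mx (fun y z => (y == z)%:R).
Proof. by apply/matrixP=> a b; rewrite !mxE (inj_eq (bij_inj nth_vertex_bij)). Qed.

Section Scheme.
Variables (I : finType) (Rel : I -> rel X).
Local Notation E_ := (dual_idempotent K Rel x).

Lemma adjacency_kernel r : adjacency K Rel x r = kernel_mx (fun y z => (Rel r y z)%:R).
Proof. by []. Qed.

Lemma adjacency_sum (P : pred I) : \sum_(r | P r) adjacency K Rel x r
  = kernel_mx (fun y z => \sum_(r | P r) (Rel r y z)%:R).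
Proof. by rewrite -kernel_mx_sum; apply: eq_bigr. Qed.

Lemma dual_idempotentMl r f :
  E_ r * kernel_mx f = kernel_mx (fun y z => (Rel r x y)%:R * f y z).
Proof. by apply/matrixP=> a b; rewrite -mulmxE mul_diag_mx !mxE. Qed.

Lemma dual_idempotentMr r f :
  kernel_mx f * E_ r = kernel_mx (fun y z => f y z * (Rel r x z)%:R).
Proof. by apply/matrixP=> a b; rewrite -mulmxE mul_mx_diag !mxE. Qed.

Lemma kernel_mx_block_sum f r a :
  (kernel_mx f *m (E_ r *m ones_vector K X)) a 0 = \sum_w f (nv a) w * (Rel r x w)%:R.
Proof.
rewrite mxE -sum_nth_vertex; apply: eq_bigr => b _.
by rewrite mul_diag_mx !mxE mulr1.
Qed.

End Scheme.
End Kernels.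

(** * Kernels of the matrices G and F *)

Section Wreath.
Variables (R : realType) (d : nat) (p : 'I_d -> nat) (x : vertex p).
Local Notation K := R[i].
Local Notation X := (vertex p).
Local Notation rel_ := (@cyclic_wreath d p).
Local Notation n_ := (valency (@cyclic_wreath d p) x).
Local Notation A_ := (adjacency K (@cyclic_wreath d p) x).
Local Notation E_ := (dual_idempotent K (@cyclic_wreath d p) x).
Local Notation kmx := (@kernel_mx K X x).
Local Notation label_of h k := (Tagged (fun i : 'I_d => 'I_(p i).-1) (k : 'I_(p h).-1)).

Lemma order_gt0 i : (0 < p i)%N. Proof. exact: leq_trans (ltn_ord (x i)). Qed.

Definition zeta (h : 'I_d) : K := Defs.root_of_unity R (p h).

Lemma zeta_prim h : (p h).-primitive_root (zeta h).
Proof. exact/root_of_unity_primitive/order_gt0. Qed.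

(** The kernel of F: inside the block u, it averages over the coordinates below
    h and projects onto the character xi of the coordinate h. *)
Definition Fkernel (u : label p) (h : 'I_d) (xi : nat) (y z : X) : K :=
  (rel_ (Some u) x y && agree h.+1 y z)%:R *
  ((zeta h ^+ (z h * xi) / zeta h ^+ (y h * xi)) / (p h * width p h)%:R).

Lemma norm_factor_neq0 h : (p h * width p h)%:R != 0 :> K.
Proof.
by rewrite pnatr_eq0 -lt0n -widthS; apply: prodn_cond_gt0 => j _; apply: order_gt0.
Qed.

Lemma valencyE u : n_ (Some u) = width p (tag u).
Proof.
have [y xy] := block_exists x (Some u).
rewrite /valency -(card_agree (tag u) y) cardsE; apply: eq_card => w.
by rewrite [LHS](blockE _ xy).
Qed.

Lemma valency_level r s : level r = level s -> n_ r = n_ s.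
Proof. by case: r s => [u|] [v|] //= [/ord_inj uv]; rewrite !valencyE uv. Qed.

Lemma valency_gt0 r : (0 < n_ r)%N.
Proof.
by have [y xy] := block_exists x r; apply/card_gt0P; exists y; rewrite inE.
Qed.

Lemma valency_neq0 r : (n_ r)%:R != 0 :> K.
Proof. by rewrite pnatr_eq0 -lt0n valency_gt0. Qed.

(** In the first two cases of the definition the block of larger level, say s,
    has tag j such that all vertices of the other block agree with x at the
    coordinates >= j; the middle factor then relates every pair, as J does. *)
Lemma Gmx_kernel r s : Gmx R x r s =
  kmx (fun y z => (n_ s)%:R^-1 * ((rel_ r x y)%:R * (rel_ s x z)%:R)).
Proof.
have blocks m y z : (level r <= m)%N -> rel_ r x y -> agree m x y.
  by move=> lm xy; rewrite -(cyclic_wreath_agree _ xy).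
rewrite /Gmx; case: ltngtP => [rs|sr|rs].
- rewrite adjacency_kernel dual_idempotentMl dual_idempotentMr kernel_mxZ.
  apply: eq_kernel_mx => y z; rewrite -!natrM !mulnb; congr (_ * (nat_of_bool _)%:R).
  case xy: (rel_ r x y) => //=; case: s rs => // v rv.
  rewrite (@rel_agree _ _ v y x z z) ?agree_refl ?andbb //.
  by rewrite agree_sym (blocks _ _ _ rv).
- rewrite adjacency_kernel kernel_mx_tr dual_idempotentMl dual_idempotentMr kernel_mxZ.
  apply: eq_kernel_mx => y z; rewrite -!natrM !mulnb; congr (_ * (nat_of_bool _)%:R).
  case xz: (rel_ s x z); rewrite ?andbF // !andbT; case: r sr blocks => // u su blocks.
  rewrite (@rel_agree _ _ u z x y y) ?agree_refl ?andbb //.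
  by rewrite agree_sym -(cyclic_wreath_agree _ xz).
rewrite (all_ones_kernel _ x) dual_idempotentMl dual_idempotentMr kernel_mxZ.
rewrite (valency_level rs).
by apply: eq_kernel_mx => y z; rewrite mulr1.
Qed.

(** The relations of level at most h add up to agreement at the coordinates
    >= h, which supplies the missing shift 0 in the character sum. *)
Lemma Fmx_kernel (u v : label p) : (tag v < tag u)%N ->
  Fmx R x u v = kmx (Fkernel u (tag v) (tagged v).+1).
Proof.
move=> vu; rewrite /Fmx; set h := tag v; set xi := (tagged v).+1.
set M := _ + _; have -> : M = kmx (fun y z => (agree h.+1 y z)%:R *
    (zeta h ^+ (z h * xi) / zeta h ^+ (y h * xi))).
  rewrite /M adjacency_sum.
  under [X in _ + X]eq_bigr => k _ do rewrite adjacency_kernel kernel_mxZ.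
  rewrite kernel_mx_sum kernel_mxD; apply: eq_kernel_mx => y z.
  rewrite sum_level agreeS.
  under eq_bigr => k _ do rewrite /= -[[forall j, _]]/(agree h.+1 y z) -/(zeta h).
  case: (agree h.+1 y z) => /=; last first.
    by rewrite mul0r add0r big1 // => k _; rewrite mulr0.
  by rewrite mul1r -(sum_shift_delta (zeta_prim h)).
rewrite dual_idempotentMl dual_idempotentMr kernel_mxZ; apply: eq_kernel_mx => y z.
rewrite valencyE -natrM /Fkernel mulrC -!mulrA.
case yz: (agree h.+1 y z); last by rewrite andbF !mul0r !mulr0.
rewrite andbT mul1r (block_agree _ (m := h.+1) _ yz); last by rewrite ltnS.
by case: (rel_ _ x z); rewrite ?mul0r // !mul1r.
Qed.

(** A class of agreement above h that meets the block u lies inside it, and over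
    such a class the sum is that of a nontrivial character. *)
Lemma Fkernel_row_sum (u : label p) (h : 'I_d) xi r y :
    (h < tag u)%N -> (0 < xi < p h)%N ->
  \sum_w Fkernel u h xi y w * (rel_ r x w)%:R = 0.
Proof.
move=> hu xi_p.
pose c := (rel_ (Some u) x y)%:R * (r == Some u)%:R / zeta h ^+ (y h * xi)
  / (p h * width p h)%:R : K.
transitivity (\sum_(w | agree h.+1 y w) c * zeta h ^+ (w h * xi)).
  rewrite [RHS]big_mkcond; apply: eq_bigr => w _; rewrite /Fkernel.
  case yw: (agree h.+1 y w); last by rewrite andbF !mul0r.
  rewrite andbT (block_agree x (r := Some u) _ yw) // /c.
  rewrite (block_agree x (r := Some u) _ yw) //.
  case xuw: (rel_ _ x w); last by rewrite !mul0r.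
  suff -> : rel_ r x w = (r == Some u) by rewrite !mul1r; ring.
  by apply/idP/eqP => [/cyclic_wreath_inj/(_ xuw)|->].
by rewrite -mulr_sumr (sum_agree y (fun a => zeta h ^+ (a * xi)))
  (sum_char (zeta_prim h)) // mul0rn mulr0.
Qed.

Lemma Fkernel_col_sum (u : label p) (h : 'I_d) xi r z :
    (h < tag u)%N -> (0 < xi < p h)%N ->
  \sum_w (rel_ r x w)%:R * Fkernel u h xi w z = 0.
Proof.
move=> hu xi_p.
pose c := (rel_ (Some u) x z)%:R * (r == Some u)%:R * zeta h ^+ (z h * xi)
  / (p h * width p h)%:R : K.
transitivity (\sum_(w | agree h.+1 z w) c * (zeta h ^+ (w h * xi))^-1).
  rewrite [RHS]big_mkcond; apply: eq_bigr => w _; rewrite /Fkernel agree_sym.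
  case zw: (agree h.+1 z w); last by rewrite andbF !mul0r mulr0.
  rewrite andbT /c (block_agree x (r := Some u) _ zw) //.
  case xuw: (rel_ (Some u) x w); last by rewrite !mul0r mulr0.
  suff -> : rel_ r x w = (r == Some u) by rewrite !mul1r; ring.
  by apply/idP/eqP => [/cyclic_wreath_inj/(_ xuw)|->].
by rewrite -mulr_sumr (sum_agree z (fun a => (zeta h ^+ (a * xi))^-1))
  (sum_charV (zeta_prim h)) // mul0rn mulr0.
Qed.

(** If h < h', the second factor is constant on the classes of agreement above h
    over which the character of the first one sums to 0; the case h' < h is
    symmetric, and h = h' is the orthogonality of characters. *)
Lemma Fkernel_mul (u u' : label p) (h h' : 'I_d) xi xi' y z :
    (h < tag u)%N -> (h' < tag u')%N -> (0 < xi < p h)%N -> (0 < xi' < p h')%N ->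
  \sum_w Fkernel u h xi y w * Fkernel u' h' xi' w z
  = [&& u == u', h == h' & xi == xi']%:R * Fkernel u h xi y z.
Proof.
move=> hu hu' xi_p xi_p'.
have [uu'|/eqP uu'] := eqVneq u u'; last first.
  rewrite mul0r big1 // => w _; rewrite /Fkernel.
  case yw: (agree h.+1 y w); last by rewrite andbF !mul0r.
  rewrite andbT (block_agree x (r := Some u) _ yw) //.
  case xuw: (rel_ _ x w); last by rewrite !mul0r.
  case xuw': (rel_ _ x w); last by rewrite !mul0r mulr0.
  by case: uu'; case: (cyclic_wreath_inj xuw xuw').
rewrite -uu' in hu' *.
have [hh'|h'h|/ord_inj hh'] := ltngtP h h'.
- rewrite -val_eqE /= ltn_eqF //= mul0r.
  pose c := (rel_ (Some u) x y && agree h'.+1 y z)%:R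
    * (zeta h' ^+ (z h' * xi') / zeta h' ^+ (y h' * xi')) / zeta h ^+ (y h * xi)
    / (p h * width p h)%:R / (p h' * width p h')%:R : K.
  transitivity (\sum_(w | agree h.+1 y w) c * zeta h ^+ (w h * xi)).
    rewrite [RHS]big_mkcond; apply: eq_bigr => w _; rewrite /Fkernel.
    case yw: (agree h.+1 y w); last by rewrite andbF !mul0r.
    rewrite andbT -(block_agree x (r := Some u) _ yw) // /c.
    rewrite -(agree_transl z (agree_mono (leqW hh') yw)) (agreeP _ _ _ yw h') //.
    by case: (rel_ _ x y); rewrite ?mul0r //= !mul1r; ring.
  by rewrite -mulr_sumr (sum_agree y (fun a => zeta h ^+ (a * xi)))
    (sum_char (zeta_prim h)) // mul0rn mulr0.
- rewrite -val_eqE /= gtn_eqF //= mul0r.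
  pose c := (rel_ (Some u) x z && agree h.+1 z y)%:R
    * (zeta h ^+ (z h * xi) / zeta h ^+ (y h * xi)) * zeta h' ^+ (z h' * xi')
    / (p h * width p h)%:R / (p h' * width p h')%:R : K.
  transitivity (\sum_(w | agree h'.+1 z w) c * (zeta h' ^+ (w h' * xi'))^-1).
    rewrite [RHS]big_mkcond; apply: eq_bigr => w _; rewrite /Fkernel (agree_sym _ w z).
    case zw: (agree h'.+1 z w); last by rewrite andbF !mul0r mulr0.
    rewrite andbT /c (block_agree x (r := Some u) _ zw) //.
    rewrite (agree_transl y (agree_mono (leqW h'h) zw)) (agree_sym _ w y).
    rewrite -(agreeP _ _ _ zw h) //.
    case yw: (agree h.+1 y w); last by rewrite !andbF !mul0r.
    rewrite (block_agree x (r := Some u) _ yw) // !andbT.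
    by case: (rel_ _ x w); rewrite ?mul0r // !mul1r; ring.
  by rewrite -mulr_sumr (sum_agree z (fun a => (zeta h' ^+ (a * xi'))^-1))
    (sum_charV (zeta_prim h')) // mul0rn mulr0.
move: xi_p'; rewrite -hh' eqxx => /andP[xi_gt0' lt_xi'] {hh' h' hu'}.
case/andP: xi_p => xi_gt0 lt_xi.
pose c := (rel_ (Some u) x y && agree h.+1 y z)%:R
  * (zeta h ^+ (z h * xi') / zeta h ^+ (y h * xi))
  / (p h * width p h)%:R / (p h * width p h)%:R : K.
transitivity (\sum_(w | agree h.+1 y w)
    c * (zeta h ^+ (w h * xi) / zeta h ^+ (w h * xi'))).
  rewrite [RHS]big_mkcond; apply: eq_bigr => w _; rewrite /Fkernel.
  case yw: (agree h.+1 y w); last by rewrite andbF !mul0r.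
  rewrite andbT -(block_agree x (r := Some u) _ yw) // /c -(agree_transl z yw).
  by case: (rel_ _ x y); rewrite ?mul0r //= !mul1r; ring.
rewrite -mulr_sumr (sum_agree y (fun a => zeta h ^+ (a * xi) / zeta h ^+ (a * xi'))).
rewrite (char_orthogonal (zeta_prim h)) // /= /c /Fkernel.
have [<-|_] := eqVneq xi xi'; last by rewrite !mul0r mul0rn mulr0.
rewrite !mulr1n !mul1r -mulrnA -!mulrA mulVf ?mulr1 //.
exact: norm_factor_neq0.
Qed.


(** * The products of the matrices G and F *)

Definition pair_index := {w : label p * label p | (tag w.2 < tag w.1)%N}.
Definition Fpair (w : pair_index) : vmatrix K X := Fmx R x (val w).1 (val w).2.

Lemma xi_range (v : label p) : (0 < (tagged v).+1 < p (tag v))%N.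
Proof. by rewrite /= -ltn_predRL. Qed.

Lemma pair_index_lt (w : pair_index) : (tag (val w).2 < tag (val w).1)%N.
Proof. by case: w. Qed.

Lemma Fpair_kernel w : Fpair w =
  kmx (Fkernel (val w).1 (tag (val w).2) (tagged (val w).2).+1).
Proof. exact/Fmx_kernel/pair_index_lt. Qed.

Lemma block_inner_product r s :
  \sum_w (rel_ r x w)%:R * (rel_ s x w)%:R = (r == s)%:R * (n_ r)%:R :> K.
Proof.
have [<-|/eqP rs] := eqVneq r s; last first.
  rewrite mul0r big1 // => w _; case xrw: (rel_ r x w); rewrite ?mul0r //.
  case xsw: (rel_ s x w); rewrite ?mulr0 //.
  by case: rs; apply: cyclic_wreath_inj xrw xsw.
rewrite mulr1n mul1r /valency cardsE -sum1_card natr_sum [RHS]big_mkcond.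
apply: eq_bigr => w _; rewrite -natrM mulnb andbb -[X in if X then _ else _]/(rel_ r x w).
by case: (rel_ r x w).
Qed.

Lemma Gmx_mul r s t u : Gmx R x r s * Gmx R x t u = (s == t)%:R *: Gmx R x r u.
Proof.
rewrite !Gmx_kernel kernel_mxM kernel_mxZ; apply: eq_kernel_mx => y z.
pose c : K := (n_ s)%:R^-1 * (n_ u)%:R^-1 * (rel_ r x y)%:R * (rel_ u x z)%:R.
transitivity (\sum_w c * ((rel_ s x w)%:R * (rel_ t x w)%:R)).
  by apply: eq_bigr => w _; rewrite /c; ring.
rewrite -mulr_sumr block_inner_product /c; field.
by rewrite !valency_neq0.
Qed.

Lemma Gmx_neq0 r : Gmx R x r r != 0.
Proof.
have [y xy] := block_exists x r; apply: contraNneq (valency_neq0 r).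
rewrite Gmx_kernel => /(kernel_mx_entry y y)/eqP.
by rewrite xy !mulr1 invr_eq0.
Qed.

Lemma Fpair_mul w w' : Fpair w * Fpair w' = (w == w')%:R *: Fpair w.
Proof.
rewrite !Fpair_kernel kernel_mxM kernel_mxZ; apply: eq_kernel_mx => y z.
rewrite (Fkernel_mul _ _ (pair_index_lt w) (pair_index_lt w')) ?xi_range //.
rewrite -[w == w']/(val w == val w'); congr ((nat_of_bool _)%:R * _).
case: (val w) (val w') => u [h k] [u' [h' k']] /=.
rewrite xpair_eqE -tag_eqE /tag_eq /=; congr (_ && _).
have [hh|//] := eqVneq h h'; move: k'; rewrite -hh => k'.
by rewrite tagged_asE eqSS.
Qed.

Lemma Fpair_neq0 w : Fpair w != 0.
Proof.
have [y xy] := block_exists x (Some (val w).1); apply/eqP.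
rewrite Fpair_kernel => /(kernel_mx_entry y y)/eqP.
rewrite /Fkernel xy agree_refl mul1r mulf_eq0 invr_eq0 (negPf (norm_factor_neq0 _)) orbF.
rewrite divff ?oner_eq0 // expf_neq0 //; exact: prim_root_neq0 (zeta_prim _).
Qed.

Lemma Gmx_Fpair r s w : Gmx R x r s * Fpair w = 0.
Proof.
rewrite Gmx_kernel Fpair_kernel kernel_mxM -(kernel_mx0 K x).
apply: eq_kernel_mx => y z.
transitivity (\sum_v (n_ s)%:R^-1 * (rel_ r x y)%:R * ((rel_ s x v)%:R *
    Fkernel (val w).1 (tag (val w).2) (tagged (val w).2).+1 v z)).
  by apply: eq_bigr => v _; ring.
by rewrite -mulr_sumr Fkernel_col_sum ?mulr0 ?xi_range //; apply: pair_index_lt.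
Qed.

Lemma Fpair_Gmx r s w : Fpair w * Gmx R x r s = 0.
Proof.
rewrite Gmx_kernel Fpair_kernel kernel_mxM -(kernel_mx0 K x).
apply: eq_kernel_mx => y z.
transitivity (\sum_v Fkernel (val w).1 (tag (val w).2) (tagged (val w).2).+1 y v
    * (rel_ r x v)%:R * ((n_ s)%:R^-1 * (rel_ s x z)%:R)).
  by apply: eq_bigr => v _; ring.
by rewrite -mulr_suml Fkernel_row_sum ?mul0r ?xi_range //; apply: pair_index_lt.
Qed.

(** The primary module is spanned by the indicator vectors of the blocks, so
    this is again the vanishing of row sums. *)
Lemma Fpair_nonprimary w : nonprimary rel_ x <[Fpair w]>%VS.
Proof.
move=> _ v /vlineP[k ->] /mem_span_image[c ->].
rewrite -scalemxAl mulmx_sumr big1 ?scaler0 // => r _.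
rewrite -scalemxAr; suff -> : Fpair w *m (E_ r *m ones_vector K X) = 0 by rewrite scaler0.
apply/matrixP=> a b; rewrite ord1 Fpair_kernel kernel_mx_block_sum mxE.
by rewrite Fkernel_row_sum ?xi_range //; apply: pair_index_lt.
Qed.

(** * The Terwilliger algebra is spanned by the matrices G and F *)

Local Notation V := (Uspace R x + <<[seq Fpair w | w : pair_index]>>)%VS.
Local Notation T := (cw_terwilliger R x).

Lemma Gmx_span r s : Gmx R x r s \in V.
Proof.
apply: subvP (addvSl _ _) _ _; apply: memv_span.
exact: (image_f (fun w => Gmx R x w.1 w.2) (x := (r, s))).
Qed.

Lemma Fpair_span w : Fpair w \in V.
Proof. by apply: subvP (addvSr _ _) _ _; apply/memv_span/image_f. Qed.

Lemma Fkernel_span (u : label p) (h : 'I_d) (k : 'I_(p h).-1) :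
  (h < tag u)%N -> kmx (Fkernel u h k.+1) \in V.
Proof.
move=> hu; rewrite -(@Fmx_kernel u (label_of h k) hu).
exact: (Fpair_span (exist _ (u, label_of h k) hu)).
Qed.

Lemma block_product_span r s : kmx (fun y z => (rel_ r x y && rel_ s x z)%:R) \in V.
Proof.
suff -> : kmx (fun y z => (rel_ r x y && rel_ s x z)%:R) = (n_ s)%:R *: Gmx R x r s.
  by rewrite memvZ // Gmx_span.
rewrite Gmx_kernel kernel_mxZ; apply: eq_kernel_mx => y z.
by rewrite mulVKf ?valency_neq0 // -natrM mulnb.
Qed.

Definition agree_kernel (u : label p) m (y z : X) : K :=
  (rel_ (Some u) x y && agree m y z)%:R.

Definition shift_kernel (u : label p) (h : 'I_d) (c : 'I_(p h)) (y z : X) : K :=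
  (rel_ (Some u) x y && agree h.+1 y z)%:R * (z h == (y h + c) %% p h :> nat)%N%:R.

(** Inverting the Fourier transform in the coordinate h: the trivial character
    contributes the kernel of agreement above h, the other ones the F. *)
Lemma shift_kernel_fourier u (h : 'I_d) (c : 'I_(p h)) :
  kmx (shift_kernel u c) = (p h)%:R^-1 *: kmx (agree_kernel u h.+1)
    + \sum_(k < (p h).-1) ((width p h)%:R / zeta h ^+ (c * k.+1))
        *: kmx (Fkernel u h k.+1).
Proof.
under eq_bigr do rewrite kernel_mxZ.
rewrite kernel_mx_sum kernel_mxZ kernel_mxD; apply: eq_kernel_mx => y z.
rewrite /shift_kernel /agree_kernel /Fkernel.
case: (rel_ _ x y && _); last first.
  by rewrite mul0r mulr0 add0r big1 // => k _; rewrite mul0r mulr0.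
have p_neq0 : (p h)%:R != 0 :> K by rewrite pnatr_eq0 -lt0n order_gt0.
apply: (mulIf p_neq0); rewrite mul1r -(fourier_inversion (zeta_prim h)).
pose f k : K := zeta h ^+ (z h * k) / zeta h ^+ (y h * k) / zeta h ^+ (c * k).
rewrite -(big_mkord xpredT f) -[X in index_iota _ X](prednK (order_gt0 h)).
rewrite big_mkord big_ord_recl /= mulrDl mulr1 mulVf //; congr (_ + _).
  by rewrite /f !muln0 !divr1.
rewrite mulr_suml; apply: eq_bigr => k _; rewrite /f /bump /= add1n.
have := norm_factor_neq0 h; rewrite natrM mulf_eq0 negb_or => /andP[_ w_neq0].
have zeta_neq0 n : zeta h ^+ n != 0.
  by rewrite expf_neq0 // (prim_root_neq0 (zeta_prim h)).
by field; rewrite !zeta_neq0 p_neq0 w_neq0.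
Qed.

(** Agreement at the coordinates >= tag u is automatic inside the block u, so
    this kernel is that of E_u J E_u, a multiple of G_uu. *)
Lemma agree_kernel_top (u : label p) : kmx (agree_kernel u (tag u)) \in V.
Proof.
suff -> : kmx (agree_kernel u (tag u)) =
    kmx (fun y z => (rel_ (Some u) x y && rel_ (Some u) x z)%:R).
  exact: block_product_span.
apply: eq_kernel_mx => y z; rewrite /agree_kernel.
by case xuy: (rel_ _ x y) => //; rewrite (blockE z xuy).
Qed.

Lemma shift_kernel_span_of (u : label p) (h : 'I_d) (c : 'I_(p h)) : (h < tag u)%N ->
  kmx (agree_kernel u h.+1) \in V -> kmx (shift_kernel u c) \in V.
Proof.
move=> hu agrV; rewrite shift_kernel_fourier memvD ?memvZ // memv_suml // => k _.
by rewrite memvZ // Fkernel_span.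
Qed.

(** Downward induction on m: the kernel for m is the shift by 0 of the
    coordinate m, hence a combination of matrices F and of the kernel for
    m.+1. *)
Lemma agree_kernel_span (u : label p) m :
  (m <= tag u)%N -> kmx (agree_kernel u m) \in V.
Proof.
move=> mu; rewrite -(subKn mu).
elim: (tag u - m)%N (leq_subr m (tag u)) => [|j IHj] lt_j.
  by rewrite subn0 agree_kernel_top.
have lt_h : (tag u - j.+1 < d)%N by rewrite (leq_ltn_trans (leq_subr _ _)).
pose h := Ordinal lt_h.
have hS : (h.+1 = tag u - j)%N by rewrite /= subnSK.
have -> : kmx (agree_kernel u h) = kmx (shift_kernel u (Ordinal (order_gt0 h))).
  apply: eq_kernel_mx => y z; rewrite /agree_kernel /shift_kernel agreeS.
  by rewrite addn0 modn_small // -natrM mulnb andbA (eq_sym (y h)).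
apply: shift_kernel_span_of; last by rewrite hS IHj // ltnW.
by rewrite /= ltn_subrL (leq_ltn_trans _ lt_j).
Qed.

Lemma shift_kernel_span (u : label p) (h : 'I_d) (c : 'I_(p h)) :
  (h < tag u)%N -> kmx (shift_kernel u c) \in V.
Proof. by move=> hu; apply: shift_kernel_span_of => //; apply: agree_kernel_span. Qed.

(** Off the diagonal a corner is 0 or a multiple of a matrix G; on the diagonal
    a relation of tag at least that of the block does not occur inside it, the
    other relations are shifts of one coordinate, and the block of x is a
    singleton. *)
Lemma corner_span r k s : E_ r * A_ k * E_ s \in V.
Proof.
rewrite adjacency_kernel dual_idempotentMl dual_idempotentMr.
set f := fun y z : X => _.
have [rs|rs] := eqVneq r s; last first.
  have [[[y0 z0] /= /and3P[xry0 xsz0 kyz0]]|none] :=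
      pickP (fun w : X * X => [&& rel_ r x w.1, rel_ s x w.2 & rel_ k w.1 w.2]).
    suff -> : kmx f = kmx (fun y z => (rel_ r x y && rel_ s x z)%:R).
      exact: block_product_span.
    apply: eq_kernel_mx => y z; rewrite /f -!natrM !mulnb; congr (nat_of_bool _)%:R.
    case xry: (rel_ r x y) => //=; case xsz: (rel_ s x z); rewrite ?andbF // andbT.
    exact: rel_between_blocks rs xry0 xry xsz0 xsz kyz0.
  suff -> : kmx f = 0 by rewrite mem0v.
  rewrite -(kernel_mx0 K x); apply: eq_kernel_mx => y z; rewrite /f -!natrM !mulnb.
  by have /= := none (y, z); rewrite andbAC -andbA => ->.
rewrite -rs in f *; case: r @f {rs} => [u|] f.
  case: k @f => [v|] f; last first.
    suff -> : kmx f = kmx (agree_kernel u 0) by apply: agree_kernel_span.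
    apply: eq_kernel_mx => y z; rewrite /f /agree_kernel agree0 -!natrM !mulnb.
    rewrite -[rel_ None y z]/(y == z).
    by case: (y =P z) => [->|_]; rewrite ?andbF // !andbT andbb.
  have [vu|uv] := ltnP (tag v) (tag u).
    have /andP[_ lt_c] := xi_range v.
    suff -> : kmx f = kmx (shift_kernel u (Ordinal lt_c)) by apply: shift_kernel_span.
    apply: eq_kernel_mx => y z; rewrite /f /shift_kernel -!natrM !mulnb.
    congr (nat_of_bool _)%:R.
    rewrite /= -[[forall j, _ ==> (y j == z j)]]/(agree (tag v).+1 y z).
    case yz: (agree _ y z); last by rewrite !andbF.
    rewrite -/(rel_ (Some u) x y) -/(rel_ (Some u) x z).
    rewrite -(block_agree x (r := Some u) _ yz) // andbT andTb /cyclic_rel.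
    by rewrite andbAC andbb.
  suff -> : kmx f = 0 by rewrite mem0v.
  rewrite -(kernel_mx0 K x); apply: eq_kernel_mx => y z; rewrite /f -!natrM !mulnb.
  case xuy: (rel_ (Some u) x y) => //.
  case xuz: (rel_ (Some u) x z); last by rewrite !andbF.
  rewrite (blockE z xuy) in xuz; case yvz: (rel_ (Some v) y z) => //.
  have : (level (Some v) <= tag u)%N by rewrite (cyclic_wreath_agree _ yvz).
  by rewrite /= ltnNge uv.
suff -> : kmx f =
    (rel_ k x x)%:R *: kmx (fun y z => (rel_ None x y && rel_ None x z)%:R).
  by rewrite memvZ // block_product_span.
rewrite kernel_mxZ; apply: eq_kernel_mx => y z; rewrite /f /=.
by case: eqP => [<-|]; case: eqP => [<-|] //=; rewrite ?mulr0 ?mul0r // !mulr1 mul1r.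
Qed.

(** The blocks partition the vertices, so the E_r add up to 1. *)
Lemma corner_decomposition M : M = \sum_r \sum_s E_ r * M * E_ s.
Proof.
have sum1 : \sum_r E_ r = 1.
  have E1 r : E_ r = E_ r * 1 by rewrite mulr1.
  rewrite (eq_bigr _ (fun r _ => E1 r)) (one_kernel K x).
  under eq_bigr do rewrite dual_idempotentMl.
  rewrite kernel_mx_sum; apply: eq_kernel_mx => y z; rewrite -mulr_suml.
  have [r xy] := cyclic_wreath_exists x y.
  by rewrite (sum_rel _ predT xy) mul1r.
rewrite -[LHS]mul1r -[LHS]mulr1 -{1}sum1 -sum1 mulr_suml mulr_suml.
by apply: eq_bigr => r _; rewrite mulr_sumr.
Qed.

Lemma adjacency_span k : A_ k \in V.
Proof.
by rewrite [A_ k]corner_decomposition; do 2!apply: memv_suml => ? _; apply: corner_span.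
Qed.

Lemma adjacency_None : A_ None = 1.
Proof. by rewrite adjacency_kernel (one_kernel K x). Qed.

Lemma dual_idempotent_span r : E_ r \in V.
Proof.
suff -> : E_ r = E_ r * A_ None * E_ r by apply: corner_span.
rewrite adjacency_None mulr1 -{2}[E_ r]mulr1 (one_kernel K x) dual_idempotentMl.
rewrite dual_idempotentMr -[LHS]mulr1 (one_kernel K x) dual_idempotentMl.
apply: eq_kernel_mx => y z.
by case: (y =P z) => [->|]; rewrite ?mulr0 ?mul0r // mulr1 -natrM mulnb andbb.
Qed.

Lemma adjacency_terwilliger k : A_ k \in T.
Proof.
by apply: (subvP (sub_agenv _)); apply: memv_span; rewrite mem_cat image_f.
Qed.

Lemma dual_idempotent_terwilliger r : E_ r \in T.
Proof.
by apply: (subvP (sub_agenv _)); apply: memv_span; rewrite mem_cat orbC image_f.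
Qed.

Lemma all_ones_terwilliger : all_ones K X \in T.
Proof.
suff -> : all_ones K X = \sum_r A_ r.
  by apply: memv_suml => r _; apply: adjacency_terwilliger.
rewrite adjacency_sum (all_ones_kernel K x); apply: eq_kernel_mx => y z.
by have [r yz] := cyclic_wreath_exists y z; rewrite (sum_rel _ predT yz).
Qed.

(** Through its kernel G_rs becomes a multiple of E_r J E_s, which avoids the
    transposed adjacency matrix of the definition. *)
Lemma Gmx_terwilliger r s : Gmx R x r s \in T.
Proof.
suff -> : Gmx R x r s = (n_ s)%:R^-1 *: (E_ r * all_ones K X * E_ s).
  by rewrite memvZ // !memvM ?all_ones_terwilliger ?dual_idempotent_terwilliger.
rewrite Gmx_kernel (all_ones_kernel K x) dual_idempotentMl dual_idempotentMr.
rewrite kernel_mxZ.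
by apply: eq_kernel_mx => y z; rewrite mulr1.
Qed.

Lemma Fmx_terwilliger u v : Fmx R x u v \in T.
Proof.
rewrite /Fmx memvZ // !memvM ?dual_idempotent_terwilliger //.
rewrite memvD ?memv_suml // => [r _|k _].
  exact: adjacency_terwilliger.
by rewrite memvZ // adjacency_terwilliger.
Qed.

(** The span of the G and the F is closed under products and contains 1
    and the generators of T, hence it contains T. *)
Lemma terwilliger_span : (T : {vspace _}) = V.
Proof.
have VV := comb_span_mul_closed Gmx_mul Fpair_mul Gmx_Fpair Fpair_Gmx.
apply/eqP; rewrite eqEsubv; apply/andP; split.
  apply: agenv_sub_modl; first by rewrite -memvE -adjacency_None adjacency_span.
  apply: subv_trans VV; apply: prodvSl; apply/span_subvP => M; rewrite mem_cat.
  by case/orP=> /imageP[r _ ->]; [apply: adjacency_span | apply: dual_idempotent_span].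
rewrite subv_add; apply/andP; split; apply/span_subvP => M /imageP[w _ ->].
  exact: Gmx_terwilliger.
exact: Fmx_terwilliger.
Qed.

Lemma card_option_label : #|{: option (label p)}| = primary_dim p.
Proof.
by rewrite card_option card_tagged sumnE big_map big_enum /primary_dim;
  congr _.+1; apply: eq_bigr => i _; rewrite card_ord.
Qed.

Lemma card_pair_index : #|{: pair_index}| = nonprimary_count p.
Proof.
have sum_label (P : pred 'I_d) (F : 'I_d -> nat) :
    (\sum_(u : label p | P (tag u)) F (tag u) = \sum_(i < d | P i) F i * (p i).-1)%N.
  under [RHS]eq_bigr do rewrite mulnC -[(p _).-1]card_ord -sum_nat_const.
  rewrite (sig_big_dep _ (fun _ _ => true) (fun i _ => F i)) /=.
  by apply: eq_bigl => u; rewrite /= andbT.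
rewrite card_sig -sum1_card.
rewrite -(pair_big_dep xpredT (fun u v : label p => (tag v < tag u)%N)
  (fun _ _ => 1%N)) /=.
rewrite (sum_label xpredT (fun i => \sum_(v : label p | (tag v < i)%N) 1)%N).
apply: eq_bigr => i _; rewrite (sum_label (fun h : 'I_d => h < i)%N (fun=> 1%N)).
by rewrite big_distrl /=; apply: eq_bigr => h _; rewrite mul1n.
Qed.

End Wreath.

(** * The structure of the Terwilliger algebra *)

Theorem theorem4p6 (R : realType) (d : nat) (p : 'I_d -> nat) (x : vertex p)
    (hd : (0 < d)%N) (hp : forall i, (1 < p i)%N) :
  let T := cw_terwilliger R x in
  let U := Uspace R x in
  let Fs := Fmxs R x in
  [/\ (exists A : {aspace vmatrix R[i] (vertex p)},
         (A : {vspace _}) = U /\ alg_isom (subvs_of A) 'M[R[i]]_(primary_dim p)),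
      is_ideal T U /\ commutative (@alg_quot_mul _ _ T U),
      size (undup [seq M <- Fs | M != 0]) = nonprimary_count p
      /\ (forall M, M \in Fs -> M != 0 ->
            [/\ M \in 'Z(T)%VS, M * M = M, is_ideal T <[M]>%VS,
                \dim <[M]> = 1%N
              & nonprimary (@cyclic_wreath d p) x <[M]>%VS])
    & alg_isom (subvs_of T)
        ('M[R[i]]_(primary_dim p) * {ffun 'I_(nonprimary_count p) -> 'M[R[i]]_1})%type].
Proof.
move=> T U Fs.
have GG := Gmx_mul R x; have GF := Gmx_Fpair R x; have FG := Fpair_Gmx R x.
have FF := Fpair_mul R x; have G0 := Gmx_neq0 R x; have F0 := Fpair_neq0 R x.
have TV := terwilliger_span R x.
pose e r := cast_ord (card_option_label p) (enum_rank r).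
have e_bij : bijective e.
  apply: bij_comp (enum_rank_bij _).
  exists (cast_ord (esym (card_option_label p))); first exact: cast_ordK.
  exact: cast_ordKV.
pose k w := cast_ord (card_pair_index p) (enum_rank w).
have k_bij : bijective k.
  apply: bij_comp (enum_rank_bij _).
  exists (cast_ord (esym (card_pair_index p))); first exact: cast_ordK.
  exact: cast_ordKV.
have FsP M : M \in Fs -> exists w, M = Fpair R x w.
  case/mapP=> w; rewrite mem_filter => /andP[lt_w _] ->.
  by exists (exist _ w lt_w).
split.
- exists (ASpace (unit_span_is_aspace GG G0 None)); split=> //.
  exact: (unit_span_isom GG G0 FF F0 GF FG e_bij).
- split; first exact: (unit_span_ideal GG GF FG TV).
  exact: (quotient_commutative GG FF GF FG TV).
- split.
    have -> : [seq M <- Fs | M != 0] = Fs.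
      by apply/all_filterP/allP => M /FsP[w ->]; apply: F0.
    rewrite undup_id.
      rewrite size_map size_filter -sum1_count big_enum_cond sum1_card.
      by rewrite -card_pair_index card_sig.
    rewrite map_inj_in_uniq ?filter_uniq -?enumT ?enum_uniq // => w w'.
    rewrite !mem_filter => /andP[lt_w _] /andP[lt_w' _] eq_F.
    have := FF (exist _ w lt_w) (exist _ w' lt_w').
    have -> : Fpair R x (exist _ w' lt_w') = Fpair R x (exist _ w lt_w) by apply/esym.
    rewrite FF eqxx scale1r; have [/(congr1 val)//|_] := eqVneq; rewrite scale0r.
    by move/eqP; rewrite (negPf (F0 _)).
  move=> _ /FsP[w ->] _.
  split.
  + exact: (F_central FF GF FG TV).
  + by rewrite FF eqxx scale1r.
  + exact: (F_ideal FF GF FG TV).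
  + by rewrite dim_vline F0.
  exact: Fpair_nonprimary.
exact: (comb_span_isom GG G0 FF F0 GF FG e_bij k_bij TV).
Qed.
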